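(* Fix $\theta\in\Theta$. Let $T_\theta(\cdot,\cdot)$ be a test statistic such that $T_\theta(x,\mathcal D)$ is symmetric in the feature vectors $X_i$, $i\in\mathcal G_\theta$, and let $$\pi_\theta(X,\mathcal D)=\frac{\#\{i\in\mathcal G_\theta: T_\theta(X_i,\mathcal D_i(X))\ge T_\theta(X,\mathcal D)\}+1}{N_\theta+1}$$ be the associated nonparametric p-value. Suppose that there exists a test statistic (measurable function) $T_\theta^o:\mathcal X\to\mathbb R$ such that $$T_\theta(X,\mathcal D)\to_p T_\theta^o(X)\qquad\text{and}\qquad \mathcal L(T_\theta^o(X))\ \text{is continuous (has no atoms)}.$$ Then $$\pi_\theta(X,\mathcal D)\to_p\pi_\theta^o(X),\qquad\text{where}\quad \pi_\theta^o(x):=P_\theta\{z\in\mathcal X: T_\theta^o(z)\ge T_\theta^o(x)\}.$$ In particular, for every fixed $\alpha\in(0,1)$, $$\mathcal R_\alpha(\pi_\theta(\cdot,\mathcal D))\to_p\mathcal R_\alpha(\pi_\theta^o),$$ and, for each $b\in\Theta$, $$\mathcal I_\alpha(b,\theta\,|\,\mathcal D)\to_p\mathbb P(\pi_\theta^o(X)>\alpha\,|\,Y=b)\qquad\text{and}\qquad \widehat{\mathcal I}_\alpha(b,\theta)\to_p\mathbb P(\pi_\theta^o(X)>\alpha\,|\,Y=b).$$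
   Context: Setting. $\mathcal X$ is a measurable space (feature space), $\Theta=\{1,\dots,L\}$ with $L\ge2$. $(X,Y)$ is a random pair in $\mathcal X\times\Theta$ with $w_b:=\mathbb P(Y=b)>0$ and $P_b:=\mathcal L(X\,|\,Y=b)$ for $b\in\Theta$. The distributions $P_1,\dots,P_L$ have strictly positive densities with respect to some measure $M$ on $\mathcal X$. Training data. $\mathcal D$ consists of $(X_1,Y_1),\dots,(X_n,Y_n)$, where the labels $Y_1,\dots,Y_n\in\Theta$ are regarded as fixed (non-random), $X_1,\dots,X_n$ and $(X,Y)$ are independent, and $\mathcal L(X_i)=P_{Y_i}$. Put $\mathcal G_b:=\{i\in\{1,\dots,n\}:Y_i=b\}$ and $N_b:=\#\mathcal G_b$, all assumed strictly positive. A test statistic $T_\theta(x,\mathcal D)$ is a real-valued measurable function of $x\in\mathcal X$ and the training data, defined for every sample size and label vector. Notation. $\mathcal D_i(x)$ denotes the training data $\mathcal D$ with $X_i$ replaced by $x$ (label $Y_i$ kept). $\mathcal D_i$ denotes the training data without the observation $(X_i,Y_i)$; $\pi_\theta(X_i,\mathcal D_i)$ is the p-value computed with $\mathcal D_i$ as training data and $X_i$ as new observation. Asymptotics. All asymptotic statements (in hypotheses and conclusions) are meant as $n\to\infty$ with $N_b/n\to w_b$ for all $b\in\Theta$, i.e. along arbitrary sequences of label vectors with this property; $\to_p$ denotes convergence in probability, meaning that the difference of the two sides tends to $0$ in probability. Risk and inclusion probabilities. For a function $\pi:\mathcal X\to[0,1]$, $\mathcal R_\alpha(\pi):=\mathbb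 P(\pi(X)>\alpha)$; for data-dependent p-values, $\mathcal R_\alpha(\pi_\theta(\cdot,\mathcal D)):=\mathbb P(\pi_\theta(X,\mathcal D)>\alpha\,|\,\mathcal D)$. Further, $$\mathcal I_\alpha(b,\theta\,|\,\mathcal D):=\mathbb P(\pi_\theta(X,\mathcal D)>\alpha\,|\,Y=b,\mathcal D),\qquad \widehat{\mathcal I}_\alpha(b,\theta):=\frac{\#\{i\in\mathcal G_b:\pi_\theta(X_i,\mathcal D_i)>\alpha\}}{N_b}.$$ *)

(* Defs.v *)
From HB Require Import structures.
From mathcomp Require Import all_boot all_order all_algebra all_fingroup.
From mathcomp Require Import all_classical all_reals all_analysis.
Set Implicit Arguments.
Unset Strict Implicit.
Unset Printing Implicit Defensive.
Import Order.TTheory GRing.Theory Num.Theory.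
Import numFieldNormedType.Exports.
Local Open Scope classical_set_scope.
Local Open Scope ring_scope.

Section probability_notions.
Context (R : realType) (d : measure_display) (Omega : measurableType d).

(* P( . | B).  When Pr B = 0, [mnormalize] falls back on the junk value Pr. *)
Definition cond_probability (Pr : probability Omega R) (B : set Omega)
    (mB : measurable B) : probability Omega R :=
  mnormalize (mrestr Pr mB) Pr.

(* Z is a version of the conditional probability Q(E | G), for a
   sub-sigma-algebra G.  Versions exist by Radon-Nikodym and agree Q-almost
   everywhere. *)
Definition is_cond_prob (Q : probability Omega R) (G : set_system Omega)
    (E : set Omega) (Z : Omega -> R) : Prop :=
  [/\ forall B : set R, measurable B -> G (Z @^-1` B),
      Q.-integrable setT (EFin \o Z)
    & forall A, G A -> (\int[Q]_(w in A) (Z w)%:E = Q (E `&` A))%E].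

Definition mutually_independent (Pr : probability Omega R) (I : finType)
    (F : I -> set_system Omega) : Prop :=
  forall (J : {set I}) (A : I -> set Omega),
    (forall i, i \in J -> F i (A i)) ->
    Pr (\big[setI/setT]_(i in J) A i) = (\prod_(i in J) Pr (A i))%E.

Definition cvg_in_prob (Pr : probability Omega R) (U : nat -> Omega -> R)
    (V : Omega -> R) : Prop :=
  forall e : R, 0 < e ->
    (fun n => Pr [set w | e < `|U n w - V w|]) @ \oo --> 0%E.

End probability_notions.

Section classification.
Context (R : realType) (L : nat).

Definition class_indices (n : nat) (y : n.-tuple 'I_L) (b : 'I_L) : {set 'I_n} :=
  [set i | tnth y i == b].

Definition class_size (n : nat) (y : n.-tuple 'I_L) (b : 'I_L) : nat :=
  #|class_indices y b|.

(* D_i(x): the i-th entry is replaced by x. *)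
Definition replace_at (S : Type) (n : nat) (i : 'I_n) (x : S) (s : n.-tuple S) :
    n.-tuple S :=
  [tuple if j == i then x else tnth s j | j < n].

(* D_i: the i-th entry is removed; applied to features and labels alike. *)
Definition delete_at (S : Type) (n : nat) (i : 'I_n) (s : n.-tuple S) :
    n.-1.-tuple S :=
  [tuple tnth s (lift i j) | j < n.-1].

(* A statistic takes the sample size, the label vector, the new observation
   and the training features. *)
Definition statistic (S : Type) : Type :=
  forall n : nat, n.-tuple 'I_L -> S -> n.-tuple S -> R.

Definition measurable_statistic (d : measure_display) (S : measurableType d)
    (T : statistic S) : Prop :=
  forall (n : nat) (y : n.-tuple 'I_L),
    measurable_fun setT (fun p : S * n.-tuple S => T n y p.1 p.2).

Definition symmetric_in_class (S : Type) (T : statistic S) (theta : 'I_L) : Prop :=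
  forall (n : nat) (y : n.-tuple 'I_L) (s : {perm 'I_n}),
    perm_on (class_indices y theta) s ->
    forall (x : S) (xs : n.-tuple S),
      T n y x [tuple tnth xs (s i) | i < n] = T n y x xs.

Definition pvalue (S : Type) (T : statistic S) (theta : 'I_L)
    (n : nat) (y : n.-tuple 'I_L) (x : S) (xs : n.-tuple S) : R :=
  (#|[set i in class_indices y theta |
        T n y x xs <= T n y (tnth xs i) (replace_at i x xs)]| + 1)%:R
  / (class_size y theta + 1)%:R.

(* Cross-validated estimate of the inclusion probability I_alpha(b, theta). *)
Definition incl_estimate (S : Type) (T : statistic S) (alpha : R)
    (b theta : 'I_L) (n : nat) (y : n.-tuple 'I_L) (xs : n.-tuple S) : R :=
  #|[set i in class_indices y b |
       alpha < pvalue T theta (delete_at i y) (tnth xs i) (delete_at i xs)]|%:R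
  / (class_size y b)%:R.

(* Since the w b of interest are positive, N_b > 0 for all large n; it cannot be
   required for every n. *)
Definition asymptotic_labels (w : 'I_L -> R) (y : forall n, n.-tuple 'I_L) : Prop :=
  forall b, (fun n => (class_size (y n) b)%:R / n%:R : R) @ \oo --> w b.

Definition cvg_asymptotic (d : measure_display) (Omega : measurableType d)
    (Pr : probability Omega R) (w : 'I_L -> R)
    (U : forall n, n.-tuple 'I_L -> Omega -> R) (V : Omega -> R) : Prop :=
  forall y : (forall n, n.-tuple 'I_L), asymptotic_labels w y ->
    cvg_in_prob Pr (fun n => U n (y n)) V.

End classification.

Section sampling_model.
Context (R : realType) (L : nat) (d dO : measure_display).
Context (S : measurableType d) (Omega : measurableType dO).
Context (Pr : probability Omega R).
Context (X : {RV Pr >-> S}) (Y : Omega -> 'I_L).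

(* sigma(X, Y), 'I_L being discrete: its events are the {X \in B_Y}. *)
Definition sigma_pair : set_system Omega :=
  [set E | exists2 B : 'I_L -> set S, (forall b, measurable (B b))
           & E = [set w | B (Y w) (X w)]].

(* X_1, ..., X_n (the components of D) and (X, Y) are independent. *)
Definition independent_sample (n : nat) (D : Omega -> n.-tuple S) : Prop :=
  mutually_independent Pr (fun o : option 'I_n =>
    if o is Some i
    then preimage_set_system setT (fun w => tnth (D w) i) measurable
    else sigma_pair).

Hypothesis mY : forall b, measurable (Y @^-1` [set b]).

Definition class_weight (b : 'I_L) : R := fine (Pr (Y @^-1` [set b])).

(* P( . | Y = b) and P_b = L(X | Y = b). *)
Definition given_class (b : 'I_L) : probability Omega R :=
  cond_probability Pr (mY b).

Definition class_law (b : 'I_L) : probability S R :=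
  distribution (given_class b) X.

Definition oracle_pvalue (To : S -> R) (theta : 'I_L) (x : S) : R :=
  fine (class_law theta [set z | To x <= To z]).

Definition risk (alpha : R) (p : S -> R) : R :=
  fine (Pr [set w | alpha < p (X w)]).

End sampling_model.

(* Main.v *)
Require Import Defs.
From HB Require Import structures.
From mathcomp Require Import all_boot all_order all_algebra all_fingroup.
From mathcomp Require Import all_classical all_reals all_analysis.
From mathcomp Require Import measurable_realfun ring lra.
Set Implicit Arguments.
Unset Strict Implicit.
Unset Printing Implicit Defensive.
Import Order.TTheory GRing.Theory Num.Theory.
Import numFieldNormedType.Exports.
Local Open Scope classical_set_scope.
Local Open Scope ring_scope.

(** The nonparametric p-value compares [T(X, D)] with the values
[T(X_i, D_i(X))] obtained by exchanging the new observation with the i-th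
training observation, for [i] in class [theta].  Since [T(X, D)] is close to
[To(X)], one wants to replace every [T(X_i, D_i(X))] by [To(X_i)]; the p-value
then becomes an empirical survival function of [To] under [P_theta], evaluated
at [To(X)], and the law of large numbers finishes the argument.

The exchange is harmless because of two facts.  If the new observation has law
[P_theta], then [(X_i, D_i(X))] and [(X, D)] have the same law
([swap_at_law]), so that [T(X_i, D_i(X)) - To(X_i)] is small in probability,
uniformly in [i].  For a new observation of another class [b], the positive
densities give [P_b A <= K * P_theta A + eta] for every event [A], with [K]
depending on [eta] only ([density_domination]); this inequality passes to the
product with the law of [D] ([product_measure1_le]), so smallness of a
probability is transported from class [theta] to class [b].  A Markov bound
([markov_count]) then says that only a small fraction of the indices have
[T(X_i, D_i(X))] far from [To(X_i)].  The comparison of [To(X_i)] with [To(X)]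
can still be wrong for the indices where these two numbers nearly coincide,
but these are few as well, because [To] has no atoms ([small_ball_null]).
Lemma [pvalue_approx] adds up the errors for a fixed sample and [pvalue_cvg]
gives the convergence in probability, the empirical survival function being
handled by Chebyshev's inequality for fixed [x] ([chebyshev_count]).

For the thresholded statements, the oracle p-value has no atom at [alpha]
([survival_level_null]), hence the decisions [alpha < pi] and [alpha < pi^o]
agree with probability tending to one ([disagree_cvg]).  A version [Z] of the
conditional probability of [alpha < pi] given [D] is then close to the constant
[P(alpha < pi^o)]: on the [D]-measurable event where [Z] exceeds this constant
by [e], the conditional probability differs by at least [e] from the constant,
which costs probability of disagreement ([cond_prob_deviation]).  For the
cross-validated estimate, removing the i-th observation leaves a pair
[(X_i, D_i)] distributed as a new observation of class [b] with a sample of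
size [n - 1] ([extract_at_law]), so each summand disagrees with
[alpha < pi^o(X_i)] with small probability, uniformly in [i]
([leave_one_out_disagree_cvg]); the averages of the latter obey the law of
large numbers. *)

(** * Convergence to zero and fractions of occurring events *)

Lemma cvge0P (R : realType) (u : nat -> \bar R) : (forall n, 0 <= u n)%E ->
  u @ \oo --> 0%E <->
  forall eta : R, 0 < eta -> \forall n \near \oo, (u n <= eta%:E)%E.
Proof.
move=> u0; split.
- move=> /fine_cvgP[ufin /cvgrPdist_le ucvg] eta eta0.
  near=> n.
  have un_fin : u n \is a fin_num by near: n.
  rewrite -(fineK un_fin) lee_fin.
  have : `|0 - (fine \o u) n| <= eta by near: n; exact: ucvg.
  by rewrite sub0r normrN /=; apply: le_trans; exact: ler_norm.
- move=> ucvg; apply/fine_cvgP; split.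
    have := ucvg _ ltr01; apply: filterS => n un1.
    by rewrite ge0_fin_numE// (le_lt_trans un1)// ltry.
  apply/cvgrPdist_le => eta eta0.
  have := ucvg _ eta0; apply: filterS => n un.
  have un_fin : u n \is a fin_num by rewrite ge0_fin_numE// (le_lt_trans un)// ltry.
  rewrite sub0r normrN /= ger0_norm ?fine_ge0//.
  by rewrite -lee_fin fineK.
Unshelve. all: by end_near. Qed.

Lemma measurable_boolP (d : measure_display) (T : measurableType d) (b : T -> bool) :
  measurable_fun setT b <-> measurable [set t | b t].
Proof.
have E : b @^-1` [set true] = [set t | b t] by apply/seteqP; split.
split=> [mb|mb]; first by rewrite -E -[X in measurable X]setTI; exact: mb.
by apply: (measurable_fun_bool true); rewrite E setTI.
Qed.

Lemma indic_bool (R : realType) (T : Type) (b : T -> bool) (t : T) :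
  \1_[set t | b t] t = (b t)%:R :> R.
Proof.
by rewrite indicE; congr (nat_of_bool _)%:R; apply/idP/idP; rewrite inE.
Qed.

Section counting.
Context (R : realType) (d : measure_display) (T : measurableType d).
Context (P : probability T R) (I : finType) (J : {set I}) (b : I -> T -> bool).
Hypothesis mb : forall i, measurable [set t | b i t].

Lemma card_setEsum (t : T) :
  #|[set i in J | b i t]|%:R = \sum_(i <- enum J) \1_[set t | b i t] t :> R.
Proof.
rewrite -sum1_card natr_sum big_enum [RHS]big_mkcond /= big_mkcond /=.
by apply: eq_bigr => i _; rewrite inE indic_bool; case: (i \in J); case: (b i t).
Qed.

Lemma measurable_count :
  measurable_fun setT (fun t => #|[set i in J | b i t]|%:R : R).
Proof.
under eq_fun do rewrite card_setEsum.
by apply: measurable_sum => i; exact: measurable_indic.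
Qed.

Lemma integral_count :
  (\int[P]_t (#|[set i in J | b i t]|%:R : R)%:E = \sum_(i in J) P [set t | b i t])%E.
Proof.
under eq_integral do rewrite card_setEsum -sumEFin.
rewrite ge0_integral_sum//.
- rewrite big_enum; apply: eq_bigr => i _.
  by rewrite integral_indic// setIT.
- by move=> i; apply/measurable_EFinP/measurable_indic.
Qed.

End counting.

Lemma markov_ge0 (R : realType) (d : measure_display) (T : measurableType d)
    (P : probability T R) (g : T -> R) (c : R) :
  measurable_fun setT g -> (forall t, 0 <= g t) -> 0 < c ->
  (P [set t | (c < g t)%R] <= (c^-1)%:E * \int[P]_t (g t)%:E)%E.
Proof.
move=> mg g0 c0.
have mA : measurable [set t | c < g t].
  by apply/measurable_boolP; exact: measurable_fun_ltr.
rewrite lee_pdivlMl//.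
rewrite -[P _](_ : \int[P]_t (\1_[set t | (c < g t)%R] t)%:E = _)%E; last first.
  by rewrite integral_indic// setIT.
rewrite -ge0_integralZl_EFin//; last first.
- exact: ltW.
- by apply/measurable_EFinP; exact: measurable_indic.
apply: ge0_le_integral => //.
- by move=> t _; rewrite mule_ge0 ?lee_fin// ltW.
- apply/measurable_EFinP/measurable_funM => //; exact: measurable_indic.
- exact/measurable_EFinP.
move=> t _; rewrite -EFinM lee_fin indic_bool.
by case: (boolP (c < g t)) => [/ltW|_]; rewrite /= ?mulr1 ?mulr0.
Qed.

(** The fraction of occurring events has expectation at most [a], whatever the
dependence between the events. *)
Lemma markov_count (R : realType) (d : measure_display) (T : measurableType d)
    (P : probability T R) (I : finType) (J : {set I}) (b : I -> T -> bool)
    (a c : R) :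
  (forall i, measurable [set t | b i t]) ->
  (forall i, i \in J -> (P [set t | b i t] <= a%:E)%E) ->
  (0 < #|J|)%N -> 0 < c ->
  (P [set t | (c < #|[set i in J | b i t]|%:R / #|J|%:R)%R] <= (a / c)%:E)%E.
Proof.
move=> mb Pb J0 c0.
have N0 : 0 < #|J|%:R :> R by rewrite ltr0n.
have -> : [set t | c < #|[set i in J | b i t]|%:R / #|J|%:R] =
    [set t | c * #|J|%:R < #|[set i in J | b i t]|%:R].
  by apply/seteqP; split=> t /=; rewrite ltr_pdivlMr.
apply: le_trans (markov_ge0 _ _ _ _) _ => //.
- exact: measurable_count.
- exact: mulr_gt0.
rewrite integral_count//.
apply: (@le_trans _ _ (((c * #|J|%:R)^-1)%:E * \sum_(i in J) a%:E)%E).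
  apply: lee_wpmul2l; last exact: lee_sum.
  by rewrite lee_fin invr_ge0 mulr_ge0// ltW.
rewrite sumEFin sumr_const -EFinM lee_fin -mulr_natr.
rewrite le_eqVlt; apply/orP; left; apply/eqP; field.
by rewrite !gt_eqF.
Qed.

(** Law of large numbers in the form needed for empirical distribution
functions: the variance of the fraction is at most [1 / #|J|] because pairwise
independence cancels the cross terms. *)
Lemma chebyshev_count (R : realType) (d : measure_display) (T : measurableType d)
    (P : probability T R) (I : finType) (J : {set I}) (b : I -> T -> bool)
    (p c : R) :
  (forall i, measurable [set t | b i t]) ->
  (forall i, i \in J -> P [set t | b i t] = p%:E) ->
  (forall i j, i \in J -> j \in J -> i != j ->
     P [set t | b i t && b j t] = (p ^+ 2)%:E) ->
  (0 < #|J|)%N -> 0 < c ->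
  (P [set t | (c < `|#|[set i in J | b i t]|%:R / #|J|%:R - p|)%R]
     <= (c ^- 2 / #|J|%:R)%:E)%E.
Proof.
move=> mb Pb Pbb J0 c0; set N := #|J|.
have N0 : 0 < N%:R :> R by rewrite ltr0n.
have [i0 i0J] := card_gt0P J0.
have p0 : 0 <= p by rewrite -lee_fin -(Pb _ i0J).
pose g t : R := #|[set i in J | b i t]|%:R.
have mg : measurable_fun setT g by exact: measurable_count.
have g0 t : 0 <= g t by [].
pose h t : R := (g t - N%:R * p) ^+ 2.
have h0 t : 0 <= h t by exact: sqr_ge0.
have mh : measurable_fun setT h.
  by apply: measurable_funX; apply: measurable_funB.
(* the second moment of g counts the pairs of events that occur together *)
have Eg2 : (\int[P]_t (g t ^+ 2)%:E =
    (N%:R * p + N%:R * (N%:R - 1) * p ^+ 2)%:E)%E.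
  have gE t : g t ^+ 2 =
      #|[set ij in finset.setX J J | b ij.1 t && b ij.2 t]|%:R.
    rewrite expr2 -natrM -cardsX; congr (_%:R); apply: eq_card => -[i j].
    by rewrite !inE /= andbACA.
  under eq_integral do rewrite gE.
  rewrite integral_count; last first.
    move=> [i j] /=.
    rewrite (_ : [set t | _] = [set t | b i t] `&` [set t | b j t]).
      exact: measurableI.
    by apply/seteqP; split => t /= => [/andP[]//|[-> ->]].
  rewrite (bigID (fun ij : I * I => ij.1 == ij.2))/=.
  rewrite (eq_bigr (fun=> p%:E)); last first.
    move=> [i j] /=; rewrite !inE /= => /andP[/andP[iJ jJ] /eqP <-].
    by rewrite -(Pb _ iJ); congr (P _); apply/seteqP; split=> t/=; rewrite andbb.
  rewrite [X in (_ + X)%E](eq_bigr (fun=> (p ^+ 2)%:E)); last first.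
    by move=> [i j] /=; rewrite !inE /= => /andP[/andP[iJ jJ] ij]; exact: Pbb.
  have cardD : #|[pred ij : I * I | (ij \in finset.setX J J) && (ij.1 == ij.2)]| = N.
    have diag_inj : injective (fun i : I => (i, i)) by move=> i j [].
    rewrite -[RHS](card_imset (mem J) diag_inj).
    apply: eq_card => -[i j]; apply/idP/imsetP.
      by rewrite !inE /= => /andP[/andP[iJ _] /eqP <-]; exists i.
    by move=> [k kJ [-> ->]]; rewrite !inE /= kJ eqxx.
  have cardD' : (#|[pred ij : I * I | (ij \in finset.setX J J) && (ij.1 != ij.2)]| + N
      = N * N)%N.
    rewrite -[in RHS]cardsX -[RHS](cardID [pred ij : I * I | ij.1 == ij.2]) addnC.
    congr (_ + _)%N; last first.
      by apply: eq_card => ij; rewrite !inE andbC.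
    by rewrite -[LHS]cardD; apply: eq_card => ij; rewrite !inE.
  rewrite !sumEFin !sumr_const -EFinD; congr (_%:E).
  rewrite [X in p *+ X]cardD -!(mulr_natl p) -(mulr_natl (p ^+ 2)); congr (_ + _ * _).
  apply: (addIr N%:R); rewrite -natrD cardD' natrM; ring.
have Eg : (\int[P]_t (g t)%:E = (N%:R * p)%:E)%E.
  rewrite integral_count// (eq_bigr (fun=> p%:E))//.
  by rewrite sumEFin sumr_const mulr_natl.
have Eh : (\int[P]_t (h t)%:E <= N%:R%:E)%E.
  (* the expansion of the square, with the negative term moved to the other
     side so that all integrands are nonnegative *)
  have key : (\int[P]_t (h t)%:E + (2 * N%:R * p)%:E * \int[P]_t (g t)%:E =
     \int[P]_t (g t ^+ 2)%:E + (N%:R ^+ 2 * p ^+ 2)%:E)%E.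
    have c2 : 0 <= 2 * N%:R * p by rewrite !mulr_ge0.
    rewrite -ge0_integralZl_EFin//; [|by move=> t _; rewrite lee_fin
      |exact/measurable_EFinP].
    have mgE : measurable_fun setT (fun t => (2 * N%:R * p)%:E * (g t)%:E)%E.
      by apply/measurable_EFinP/measurable_funM.
    have mg2 : measurable_fun setT (fun t => (g t ^+ 2)%:E).
      by apply/measurable_EFinP; exact: measurable_funX.
    have mhE : measurable_fun setT (fun t => (h t)%:E) by exact/measurable_EFinP.
    rewrite -ge0_integralD//; [|by move=> t _; rewrite lee_fin
      |by move=> t _; rewrite -EFinM lee_fin mulr_ge0].
    have <- : (\int[P]_t (N%:R ^+ 2 * p ^+ 2)%:E = (N%:R ^+ 2 * p ^+ 2)%:E)%E.
      by rewrite integral_cst//= probability_setT mule1.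
    rewrite -ge0_integralD//; [|by move=> t _; rewrite lee_fin sqr_ge0
      |by move=> t _; rewrite lee_fin mulr_ge0// sqr_ge0].
    by apply: eq_integral => t _; rewrite -EFinM -!EFinD /h; congr (_%:E); ring.
  rewrite Eg Eg2 -EFinM -EFinD in key.
  have hfin : (\int[P]_t (h t)%:E)%E \is a fin_num.
    rewrite ge0_fin_numE; last by apply: integral_ge0 => t _; rewrite lee_fin.
    apply: le_lt_trans (_ : ((N%:R * p + N%:R * (N%:R - 1) * p ^+ 2 +
       N%:R ^+ 2 * p ^+ 2)%:E < +oo)%E); last exact: ltry.
    rewrite -key leeDl//.
    by rewrite lee_fin !mulr_ge0.
  move: key; rewrite -(fineK hfin) -EFinD => -[key].
  rewrite lee_fin.
  have {key} -> : fine (\int[P]_t (h t)%:E)%E = N%:R * (p - p ^+ 2).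
    by apply: (addIr (2 * N%:R * p * (N%:R * p))); rewrite key; ring.
  rewrite ler_piMr//; have := sqr_ge0 (p - 2^-1); nra.
have -> : [set t | c < `|g t / N%:R - p|] = [set t | (c * N%:R) ^+ 2 < h t].
  have E t : (c < `|g t / N%:R - p|) = ((c * N%:R) ^+ 2 < h t).
    have -> : g t / N%:R - p = (g t - N%:R * p) / N%:R.
      by field; rewrite gt_eqF.
    rewrite normf_div (gtr0_norm N0) ltr_pdivlMr// /h -[X in _ = (_ < X)]real_normK ?num_real//.
    by rewrite ltr_pXn2r// nnegrE// mulr_ge0// ltW.
  by apply/seteqP; split => t /=; rewrite E.
apply: le_trans (markov_ge0 _ mh h0 _) _.
  by rewrite exprn_gt0// mulr_gt0.
apply: (@le_trans _ _ ((((c * N%:R) ^+ 2)^-1)%:E * N%:R%:E)%E).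
  by rewrite lee_wpmul2l// lee_fin invr_ge0 sqr_ge0.
rewrite -EFinM lee_fin le_eqVlt; apply/orP; left; apply/eqP; field.
by rewrite !gt_eqF.
Qed.

(** * Tuples of independent observations *)

Definition box (S : Type) (n : nat) (A : 'I_n -> set S) : set (n.-tuple S) :=
  [set xs | forall i, A i (tnth xs i)].

Section boxes.
Context (R : realType) (d : measure_display) (S : measurableType d).

Lemma measurable_box (n : nat) (A : 'I_n -> set S) :
  (forall i, measurable (A i)) -> measurable (box A).
Proof.
move=> mA; have -> : box A = \bigcap_(i in [set: 'I_n]) (fun xs => tnth xs i) @^-1` A i.
  by apply/seteqP; split=> xs /= Axs i => [_|]; exact: Axs.
apply: fin_bigcap_measurable => // i _; rewrite -[X in measurable X]setTI.
exact: measurable_tnth.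
Qed.

(** Boxes are stable under intersection, unlike the cylinders on one coordinate
that define the sigma-algebra of tuples; they are the generators for which
uniqueness of measures applies. *)
Lemma measurable_tuple_boxes (n : nat) :
  (measurable : set (set (n.-tuple S))) =
  <<s [set B | exists2 A : 'I_n -> set S, (forall i, measurable (A i)) & B = box A] >>.
Proof.
apply/seteqP; split.
- apply: smallest_sub; first exact: smallest_sigma_algebra.
  move=> B; rewrite -bigcup_seq => -[i /= _ [A mA]]; rewrite setTI => <-.
  apply: sub_sigma_algebra => /=.
  exists (fun j => if j == i then A else setT); first by move=> j; case: ifP.
  apply/seteqP; split=> xs /= => [Axs j|/(_ i)]; last by rewrite eqxx.
  by case: eqP => // ->.
- apply: smallest_sub; first exact: sigma_algebra_measurable.
  by move=> _ [A mA ->]; exact: measurable_box.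
Qed.

Lemma tuple_measure_unique (n : nat) (m1 m2 : probability (n.-tuple S) R) :
  (forall A : 'I_n -> set S, (forall i, measurable (A i)) ->
     m1 (box A) = m2 (box A)) ->
  forall E, measurable E -> m1 E = m2 E.
Proof.
move=> m12 E mE.
apply: (measure_unique _ (fun=> setT) (measurable_tuple_boxes n)) => //.
- move=> _ _ [A mA ->] [B mB ->].
  exists (fun i => A i `&` B i); first by move=> i; exact: measurableI.
  by apply/seteqP; split=> xs /= => [[HA HB] i|H]; split=> // i; have [] := H i.
- by move=> _; exists (fun=> setT) => //; apply/seteqP; split.
- by rewrite bigcup_const.
- by move=> _ [A mA ->]; exact: m12.
- by move=> _; rewrite /= probability_setT ltry.
Qed.

(** A pair of an observation and an n-tuple is an (n+1)-tuple, which reduces this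
to [tuple_measure_unique]. *)
Lemma pair_measure_unique (n : nat) (m1 m2 : probability (S * n.-tuple S)%type R) :
  (forall (A : set S) (B : 'I_n -> set S), measurable A ->
     (forall i, measurable (B i)) -> m1 (A `*` box B) = m2 (A `*` box B)) ->
  forall E, measurable E -> m1 E = m2 E.
Proof.
move=> m12 E mE.
pose phi (p : S * n.-tuple S) := [the n.+1.-tuple S of p.1 :: p.2].
pose psi (xs : n.+1.-tuple S) := (thead xs, [tuple of behead xs]).
have mphi : measurable_fun setT phi by exact: measurable_cons.
have mpsi : measurable_fun setT psi.
  apply/measurable_fun_pairP; split; first exact: measurable_tnth.
  exact: measurable_behead.
have phiK p : psi (phi p) = p.
  by case: p => x xs; rewrite /psi /=; congr (_, _); apply/val_inj.
pose Phi : {mfun (S * n.-tuple S)%type >-> n.+1.-tuple S} :=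
  HB.pack phi (isMeasurableFun.Build _ _ _ _ phi mphi).
have -> : E = phi @^-1` (psi @^-1` E).
  by apply/seteqP; split=> p /=; rewrite phiK.
apply: (tuple_measure_unique (m1 := distribution m1 Phi) (m2 := distribution m2 Phi)).
  move=> A mA; rewrite -[LHS]/(m1 (phi @^-1` box A)) -[RHS]/(m2 (phi @^-1` box A)).
  have -> : phi @^-1` box A = A ord0 `*` box (fun i => A (lift ord0 i)).
    apply/seteqP; split=> [[x xs] /= H|[x xs] /= [H0 H] i].
      split=> [|i /=]; first exact: H ord0.
      by have := H (lift ord0 i); rewrite tnthS.
    by case: (unliftP ord0 i) => [j ->|->]; [rewrite tnthS; exact: H|].
  by apply: m12 => // i.
by rewrite -[X in measurable X]setTI; exact: mpsi.
Qed.

End boxes.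

Section surgery.
Context (d : measure_display) (S : measurableType d).

Lemma measurable_tnth_comp (d' : measure_display) (T : measurableType d') (n : nat)
    (f : T -> n.-tuple S) (i : 'I_n) :
  measurable_fun setT f -> measurable_fun setT (fun t => tnth (f t) i).
Proof.
by move=> mf; apply: (measurableT_comp (measurable_tnth i) mf).
Qed.

Lemma measurable_replace_at (n : nat) (i : 'I_n) :
  measurable_fun setT (fun p : S * n.-tuple S => replace_at i p.1 p.2).
Proof.
apply/measurable_fun_tnthP => j.
rewrite (_ : _ \o _ = fun p : S * n.-tuple S => if j == i then p.1 else tnth p.2 j).
  by case: (j == i); [exact: measurable_fst|exact: measurable_tnth_comp].
by apply/funext => p /=; rewrite tnth_mktuple.
Qed.

Lemma measurable_delete_at (n : nat) (i : 'I_n) :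
  measurable_fun setT (@delete_at S n i).
Proof.
apply/measurable_fun_tnthP => j.
rewrite (_ : _ \o _ = fun xs : n.-tuple S => tnth xs (lift i j)).
  exact: measurable_tnth.
by apply/funext => p /=; rewrite tnth_mktuple.
Qed.

(** The pair [(X_i, D_i(X))] seen as a function of [(X, D)]. *)
Definition swap_at (n : nat) (i : 'I_n) (p : S * n.-tuple S) : S * n.-tuple S :=
  (tnth p.2 i, replace_at i p.1 p.2).

(** The pair [(X_i, D_i)] seen as a function of [D]. *)
Definition extract_at (n : nat) (i : 'I_n) (xs : n.-tuple S) : S * n.-1.-tuple S :=
  (tnth xs i, delete_at i xs).

Lemma measurable_swap_at (n : nat) (i : 'I_n) : measurable_fun setT (@swap_at n i).
Proof.
apply/measurable_fun_pairP; split; last exact: measurable_replace_at.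
exact: measurable_tnth_comp.
Qed.

Lemma measurable_extract_at (n : nat) (i : 'I_n) :
  measurable_fun setT (@extract_at n i).
Proof.
apply/measurable_fun_pairP; split; last exact: measurable_delete_at.
exact: measurable_tnth.
Qed.

End surgery.

Lemma measurable_preim (d1 d2 : measure_display) (T1 : measurableType d1)
    (T2 : measurableType d2) (f : T1 -> T2) (A : set T2) :
  measurable_fun setT f -> measurable A -> measurable (f @^-1` A).
Proof. by move=> mf mA; rewrite -[X in measurable X]setTI; exact: mf. Qed.

Lemma product_probabilityE (R : realType) (d1 d2 : measure_display)
    (T1 : measurableType d1) (T2 : measurableType d2) (p : probability T1 R)
    (q : probability T2 R) (A : set T1) (B : set T2) :
  measurable A -> measurable B -> ((p \x q) (A `*` B) = p A * q B)%E.
Proof. exact: product_measure1E. Qed.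

Section independent_draws.
Context (R : realType) (d : measure_display) (S : measurableType d) (L : nat).
Context (P : 'I_L -> probability S R).
Context (Q : forall n, n.-tuple 'I_L -> probability (n.-tuple S) R).
Hypothesis Qbox : forall n (y : n.-tuple 'I_L) (A : 'I_n -> set S),
  (forall i, measurable (A i)) -> Q y (box A) = (\prod_i P (tnth y i) (A i))%E.

(** The new observation and the i-th training observation are independent with
the same law, hence exchangeable. *)
Lemma swap_at_law (n : nat) (y : n.-tuple 'I_L) (i : 'I_n)
    (E : set (S * n.-tuple S)) : measurable E ->
  (P (tnth y i) \x Q y)%E (@swap_at _ _ n i @^-1` E) = (P (tnth y i) \x Q y)%E E.
Proof.
set c := tnth y i; have mW := @measurable_swap_at _ S n i.
pose W : {mfun (S * n.-tuple S)%type >-> (S * n.-tuple S)%type} :=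
  HB.pack (@swap_at _ _ n i) (isMeasurableFun.Build _ _ _ _ (@swap_at _ _ n i) mW).
apply: (pair_measure_unique (m1 := distribution (P c \x Q y)%E W) (m2 := (P c \x Q y)%E)).
move=> A B mA mB; rewrite -[LHS]/((P c \x Q y)%E (@swap_at _ _ n i @^-1` (A `*` box B))).
have -> : @swap_at _ S n i @^-1` (A `*` box B) = B i `*` box (fun j => if j == i then A else B j).
  apply/seteqP; split=> [[x xs] [/= HA HB]|[x xs] [/= HA HB]].
    split=> [|j /=]; first by have := HB i; rewrite tnth_mktuple eqxx.
    by have := HB j; rewrite tnth_mktuple; case: eqP => // ->.
  split=> [|j /=]; first by have := HB i; rewrite eqxx.
  by have := HB j; rewrite tnth_mktuple; case: eqP => // ->.
have mB' j : measurable (if j == i then A else B j) by case: ifP.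
rewrite -[RHS]/((P c \x Q y)%E _) !product_probabilityE//; try exact: measurable_box.
rewrite !Qbox// (bigD1 i)//= eqxx [in RHS](bigD1 i)//= !muleA [X in (X * _)%E = _]muleC.
by congr (_ * _)%E; apply: eq_bigr => j /negbTE ->.
Qed.

(** Independence makes the i-th observation a fresh draw of its class for the
remaining sample, which is itself a sample with the remaining labels. *)
Lemma extract_at_law (n : nat) (y : n.-tuple 'I_L) (i : 'I_n)
    (E : set (S * n.-1.-tuple S)) : measurable E ->
  Q y (@extract_at _ _ n i @^-1` E) = (P (tnth y i) \x Q (delete_at i y))%E E.
Proof.
have mW := @measurable_extract_at _ S n i.
pose W : {mfun n.-tuple S >-> (S * n.-1.-tuple S)%type} :=
  HB.pack (@extract_at _ _ n i) (isMeasurableFun.Build _ _ _ _ (@extract_at _ _ n i) mW).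
apply: (pair_measure_unique (m1 := distribution (Q y) W)
  (m2 := (P (tnth y i) \x Q (delete_at i y))%E)).
move=> A B mA mB; rewrite -[LHS]/(Q y (@extract_at _ _ n i @^-1` (A `*` box B))).
pose C j := if unlift i j is Some k then B k else A.
have -> : @extract_at _ S n i @^-1` (A `*` box B) = box C.
  apply/seteqP; split=> [xs [/= HA HB] j|xs /= H].
    rewrite /C; case: (unliftP i j) => [k ->|->//].
    by have := HB k; rewrite tnth_mktuple.
  split=> [|k /=]; first by have := H i; rewrite /C unlift_none.
  by have := H (lift i k); rewrite /C liftK tnth_mktuple.
have mC j : measurable (C j) by rewrite /C; case: unliftP.
rewrite -[RHS]/((P (tnth y i) \x Q (delete_at i y))%E _) product_probabilityE//;
  last exact: measurable_box.
rewrite !Qbox// (bigD1_ord i)//= {1}/C unlift_none; congr (_ * _)%E.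
by apply: eq_bigr => j _; rewrite /C liftK tnth_mktuple.
Qed.

Lemma coord_law (n : nat) (y : n.-tuple 'I_L) (i : 'I_n) (A : set S) :
  measurable A -> Q y [set xs | A (tnth xs i)] = P (tnth y i) A.
Proof.
move=> mA.
have mE : measurable (A `*` [set: n.-1.-tuple S]) by exact: measurableX.
have := extract_at_law y i mE.
rewrite product_probabilityE// probability_setT mule1 => <-; congr (Q y _).
by apply/seteqP; split => xs //= [].
Qed.

Lemma coord2_law (n : nat) (y : n.-tuple 'I_L) (i j : 'I_n) (A B : set S) :
  i != j -> measurable A -> measurable B ->
  Q y [set xs | A (tnth xs i) /\ B (tnth xs j)] =
    (P (tnth y i) A * P (tnth y j) B)%E.
Proof.
move=> ij mA mB; have [k jE|jE] := unliftP i j; last by rewrite jE eqxx in ij.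
have mB' : measurable [set xs : n.-1.-tuple S | B (tnth xs k)].
  by apply: (measurable_preim (f := fun xs => tnth xs k)) => //; exact: measurable_tnth.
have := extract_at_law y i (measurableX mA mB').
rewrite product_probabilityE// coord_law// tnth_mktuple -jE => <-; congr (Q y _).
by apply/seteqP; split => xs /=; rewrite tnth_mktuple -jE.
Qed.

Lemma new_coord_law (b : 'I_L) (n : nat) (y : n.-tuple 'I_L) (i : 'I_n)
    (E : set (S * S)) : measurable E ->
  (P b \x Q y)%E [set p | E (p.1, tnth p.2 i)] = (P b \x P (tnth y i))%E E.
Proof.
move=> mE; apply: eq_integral => x _ /=.
have -> : xsection [set p : S * n.-tuple S | E (p.1, tnth p.2 i)] x =
    [set xs | xsection E x (tnth xs i)].
  by apply/seteqP; split => xs; rewrite /xsection /= !inE.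
by rewrite coord_law//; exact: measurable_xsection.
Qed.

End independent_draws.

(** The inequality holds for the sections of [E] at every point of the second
factor; integrating the sections in this order preserves it. *)
Lemma product_measure1_le (R : realType) (d1 d2 : measure_display)
    (T1 : measurableType d1) (T2 : measurableType d2) (m m' : probability T1 R)
    (q : probability T2 R) (K eta : R) (E : set (T1 * T2)) :
  0 <= K -> 0 <= eta -> measurable E ->
  (forall A, measurable A -> m A <= K%:E * m' A + eta%:E)%E ->
  ((m \x q) E <= K%:E * (m' \x q) E + eta%:E)%E.
Proof.
move=> K0 eta0 mE mm'.
have pE (mu : probability T1 R) : ((mu \x q) E = (mu \x^ q) E)%E.
  apply: product_measure_unique => // A B mA mB.
  exact: product_measure2E.
rewrite !pE /product_measure2.
have mf (mu : probability T1 R) : measurable_fun setT (mu \o ysection E).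
  exact: measurable_fun_ysection.
apply: (@le_trans _ _ (\int[q]_y (K%:E * (m' \o ysection E) y + eta%:E))%E).
  apply: ge0_le_integral => //.
  - by apply: emeasurable_funD => //; exact: measurable_funeM.
  by move=> y _ /=; apply: mm'; exact: measurable_ysection.
rewrite ge0_integralD//; [|by move=> y _; rewrite mule_ge0
  |exact: measurable_funeM].
rewrite integral_cst//= probability_setT mule1 ge0_integralZl_EFin//.
exact: (mf m').
Qed.

(** * Small balls and level sets of survival functions *)

Lemma measurable_gt_set (R : realType) (d : measure_display) (T : measurableType d)
    (c : R) (g : T -> R) :
  measurable_fun setT g -> measurable [set t | c < g t].
Proof. by move=> mg; apply/measurable_boolP; exact: measurable_fun_ltr. Qed.

Lemma measurable_le_set (R : realType) (d : measure_display) (T : measurableType d)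
    (f g : T -> R) :
  measurable_fun setT f -> measurable_fun setT g -> measurable [set t | f t <= g t].
Proof. by move=> mf mg; apply/measurable_boolP; exact: measurable_fun_ler. Qed.

(** Continuity from above along the balls of radius [1 / (k + 1)]. *)
Lemma small_ball_null (R : realType) (d : measure_display) (T : measurableType d)
    (m : probability T R) (g : T -> R) (eta : R) :
  measurable_fun setT g -> m [set t | g t = 0] = 0%E -> 0 < eta ->
  exists2 e : R, 0 < e & (m [set t | (`|g t| <= e)%R] <= eta%:E)%E.
Proof.
move=> mg g0 eta0.
pose F k := [set t | `|g t| <= k.+1%:R^-1].
have mF k : measurable (F k) by apply: measurable_le_set => //; exact: measurableT_comp.
have FE : \bigcap_k F k = [set t | g t = 0].
  apply/seteqP; split=> t /= => [Ft|gt0 k _]; last by rewrite /F /= gt0 normr0.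
  apply/eqP; rewrite -normr_le0; apply/ler_addgt0Pl => e e0; rewrite addr0.
  have [k _ ke] := near_infty_natSinv_lt (PosNum e0).
  have /= := ke k (leqnn k); move=> /ltW; apply: le_trans.
  exact: (Ft k).
have : m \o F @ \oo --> m (\bigcap_k F k).
  apply: nonincreasing_cvg_mu => //.
  - by apply: le_lt_trans (probability_le1 _ _) _ => //; rewrite ltry.
  - exact: bigcapT_measurable.
  - move=> i j ij; apply/subsetPset => t /=; rewrite /F /= => /le_trans; apply.
    by rewrite lef_pV2 ?posrE// ler_nat.
rewrite FE g0 => /cvge0P H.
have [k _ Hk] := H (fun n => measure_ge0 _ _) _ eta0.
by exists k.+1%:R^-1; [|exact: (Hk k (leqnn k))].
Qed.

(** The level set of a survival function is an interval of thresholds.  Apart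
from its two possible end points, which are not atoms, it is covered by the
countably many intervals with rational end points of the same level, and each of
them has mass [alpha - alpha = 0] under [m], hence mass zero under [m']. *)
Lemma survival_level_null (R : realType) (d : measure_display) (S : measurableType d)
    (m m' : probability S R) (g : S -> R) (alpha : R) :
  measurable_fun setT g ->
  (forall t, m' [set x | g x = t] = 0%E) ->
  (forall A, measurable A -> m A = 0 -> m' A = 0)%E ->
  m' [set x | fine (m [set z | (g x <= g z)%R]) = alpha] = 0%E.
Proof.
move=> mg atom mm'.
pose G t := fine (m [set z | (t <= g z)%R]).
have mge t : measurable [set z | t <= g z] by exact: measurable_le_set.
have G_ni s t : s <= t -> G t <= G s.
  move=> st; apply: fine_le; rewrite ?fin_num_measure//.
  by apply: le_measure; rewrite ?inE// => z /=; exact: le_trans.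
pose F k := match unpickle k with
  | Some (p, q) => if (G (ratr p) == alpha) && (G (ratr q) == alpha)
                   then [set z | ratr p <= g z] `\` [set z | ratr q <= g z] else set0
  | None => set0 end.
have mF k : measurable (F k).
  rewrite /F; case: (unpickle k) => // -[p q]; case: ifP => // _.
  exact: measurableD.
have F0 k : m' (F k) = 0%E.
  rewrite /F; case: (unpickle k) => [[p q]|]; last by rewrite measure0.
  case: ifPn => [/andP[/eqP Gp /eqP Gq]|_]; last by rewrite measure0.
  have [pq|qp] := leP (ratr p : R) (ratr q).
    apply: mm'; first exact: measurableD.
    rewrite measureD//; last by apply: le_lt_trans (probability_le1 _ _) _ => //; rewrite ltry.
    rewrite setIidr /=; last by move=> z /=; exact: le_trans.
    have <- : m [set z | ratr q <= g z] = m [set z | ratr p <= g z].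
      rewrite -(fineK (fin_num_measure m _ (mge (ratr q)))).
      rewrite -(fineK (fin_num_measure m _ (mge (ratr p)))).
      by congr (_%:E); exact: etrans Gq (esym Gp).
    by rewrite subee// fin_num_measure.
  rewrite (_ : _ `\` _ = set0) ?measure0//.
  by apply/seteqP; split => z //= [pz]; apply; exact: le_trans (ltW qp) pz.
pose lo x := forall t, G t = alpha -> g x <= t.
pose hi x := forall t, G t = alpha -> t <= g x.
have thin (B : set S) : (forall x x', B x -> B x' -> g x = g x') -> m'.-negligible B.
  move=> HB; have [->|/set0P[x0 Bx0]] := eqVneq B set0; first exact: negligible_set0.
  exists [set x | g x = g x0]; split; [|exact: atom|by move=> x /= /HB; exact].
  exact: (measurable_preim mg (measurable_set1 (g x0))).
have : m'.-negligible [set x | G (g x) = alpha].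
  apply: (negligibleS (A := ([set x | G (g x) = alpha /\ lo x] `|`
     [set x | G (g x) = alpha /\ hi x]) `|` \bigcup_k F k)).
    move=> x /= Gx.
    have [?|/existsNP[t /not_implyP[Gt /negP]]] := pselect (lo x); first by left; left.
    rewrite -ltNge => tx.
    have [?|/existsNP[u /not_implyP[Gu /negP]]] := pselect (hi x); first by left; right.
    rewrite -ltNge => xu.
    have [p /[!in_itv]/= /andP[tp px]] := rat_in_itvoo tx.
    have [q /[!in_itv]/= /andP[xq qu]] := rat_in_itvoo xu.
    have [k kE] : exists k, unpickle k = Some (p, q).
      by exists (pickle (p, q)); exact: pickleK.
    right; exists k => //; rewrite /F kE.
    have -> : G (ratr p) = alpha.
      apply/eqP; rewrite eq_le -{1}Gt -Gx !G_ni//; exact: ltW.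
    have -> : G (ratr q) = alpha.
      apply/eqP; rewrite eq_le -{1}Gx -Gu !G_ni//; exact: ltW.
    by rewrite eqxx; split=> /=; [exact: ltW|apply/negP; rewrite -ltNge].
  apply: negligibleU; first apply: negligibleU.
  - by apply: thin => x x' [Gx lx] [Gx' lx']; apply/eqP; rewrite eq_le lx// lx'.
  - by apply: thin => x x' [Gx lx] [Gx' lx']; apply/eqP; rewrite eq_le lx// lx'.
  - by apply: negligible_bigcup => k; apply/(negligibleP m' (mF k)); exact: F0.
move/negligibleP; apply.
have mG : measurable_fun setT (G \o g).
  by apply: measurableT_comp => //; apply: nonincreasing_measurable.
exact: (measurable_preim mG (measurable_set1 alpha)).
Qed.

(** * Domination through densities, and asymptotics of label vectors *)

(** A quantitative form of absolute continuity, obtained by truncating the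
likelihood ratio: where [f <= k * g] the inequality holds with [K = k], and the
sets where [f > k * g] decrease to the empty set. *)
Lemma density_domination (R : realType) (d : measure_display) (S : measurableType d)
    (M : {measure set S -> \bar R}) (m m' : probability S R) (f g : S -> R) (eta : R) :
  measurable_fun setT f -> measurable_fun setT g ->
  (forall x, 0 <= f x) -> (forall x, 0 < g x) ->
  (forall A, measurable A -> m A = \int[M]_(x in A) (f x)%:E)%E ->
  (forall A, measurable A -> m' A = \int[M]_(x in A) (g x)%:E)%E ->
  0 < eta ->
  exists2 K : R, 0 <= K &
    forall A, measurable A -> (m A <= K%:E * m' A + eta%:E)%E.
Proof.
move=> mf mg f0 g0 mE m'E eta0.
pose B k := [set x | k%:R * g x < f x].
have mB k : measurable (B k).
  by apply/measurable_boolP; apply: measurable_fun_ltr => //; exact: measurable_funM.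
have B0 : \bigcap_k B k = set0.
  apply/seteqP; split => x //= Bx.
  have [k fk] : exists k : nat, f x / g x < k%:R.
    by exists (Num.bound (f x / g x)); rewrite archi_boundP// divr_ge0// ltW.
  by have := Bx k Logic.I; rewrite /B /= ltNge -ler_pdivrMr// (ltW fk).
have : m \o B @ \oo --> m (\bigcap_k B k).
  apply: nonincreasing_cvg_mu => //.
  - by apply: le_lt_trans (probability_le1 _ _) _ => //; rewrite ltry.
  - by rewrite B0.
  - move=> i j ij; apply/subsetPset => x; rewrite /B /=; apply: le_lt_trans.
    by rewrite ler_pM2r// ler_nat.
rewrite B0 measure0 => /cvge0P H.
have [k _ Hk] := H (fun n => measure_ge0 _ _) _ eta0.
exists k%:R => // A mA.
have mAB : measurable (A `\` B k) by exact: measurableD.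
have AE : A = (A `\` B k) `|` (A `&` B k).
  apply/seteqP; split => x /=; last by case=> -[].
  by move=> Ax; have [Bx|Bx] := pselect (B k x); [right|left].
rewrite {1}AE measureU//; last 2 first.
- exact: measurableI.
- by apply/seteqP; split => x //= [[_ ?] []].
apply: leeD; last first.
  apply: le_trans (Hk k (leqnn k)) => /=.
  by apply: le_measure; rewrite ?inE//; exact: measurableI.
apply: (@le_trans _ _ (k%:R%:E * m' (A `\` B k))%E); last first.
  by apply: lee_wpmul2l => //; apply: le_measure; rewrite ?inE// => x [].
rewrite /= mE// m'E// -ge0_integralZl_EFin//.
- apply: ge0_le_integral => //.
  + by move=> x _; rewrite lee_fin.
  + by apply/measurable_EFinP; exact: measurable_funTS.
  + by apply/measurable_EFinP; apply: measurable_funTS; exact: measurable_funM.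
  + by move=> x [_ /negP]; rewrite -leNgt -EFinM lee_fin.
- by move=> x _; rewrite lee_fin ltW.
- by apply/measurable_EFinP; exact: measurable_funTS.
Qed.

Section label_asymptotics.
Context (R : realType) (L : nat).

Lemma class_size_delete_at (n : nat) (y : n.-tuple 'I_L) (i : 'I_n) (b : 'I_L) :
  class_size y b = ((tnth y i == b) + class_size (delete_at i y) b)%N.
Proof.
have Esum k (z : k.-tuple 'I_L) : class_size z b = (\sum_j (tnth z j == b))%N.
  by rewrite /class_size -sum1_card big_mkcond; apply: eq_bigr => j _; rewrite inE; case: eqP.
rewrite !Esum (bigD1_ord i)//=; congr addn.
by apply: eq_bigr => j _; rewrite tnth_mktuple.
Qed.

Lemma class_size_cvgy (w : 'I_L -> R) (y : forall n, n.-tuple 'I_L) (b : 'I_L) :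
  0 < w b -> asymptotic_labels w y ->
  forall K : R, \forall n \near \oo, K <= (class_size (y n) b)%:R.
Proof.
move=> w0 /(_ b)/cvgrPdist_le Hy K.
have w2 : 0 < w b / 2 by rewrite divr_gt0.
near=> n.
have n0 : 0 < n%:R :> R by rewrite ltr0n; near: n; exact: nbhs_infty_gt.
have : `|w b - (class_size (y n) b)%:R / n%:R| <= w b / 2 by near: n; exact: Hy.
have nK : K / (w b / 2) <= n%:R.
  by near: n; exact: nbhs_infty_ger.
rewrite ler_pdivrMr// in nK.
move=> /ler_normlP[_] H.
have {}H : w b / 2 <= (class_size (y n) b)%:R / n%:R by lra.
by move: H; rewrite ler_pdivlMr//; apply: le_trans; rewrite mulrC.
Unshelve. all: by end_near. Qed.

(** Removing one label changes every class size by at most one.  The removed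
index may be chosen adversarially for each sample size. *)
Lemma asymptotic_delete_at (w : 'I_L -> R) (y : forall n, n.-tuple 'I_L)
    (i : forall n, 'I_n.+1) :
  asymptotic_labels w y -> asymptotic_labels w (fun n => delete_at (i n) (y n.+1)).
Proof.
move=> Hy b.
have H1 : (fun n => (class_size (y n.+1) b)%:R / n.+1%:R : R) @ \oo --> w b.
  by have := Hy b; rewrite -(cvg_shiftS (fun n => (class_size (y n) b)%:R / n%:R : R)).
have H2 : (fun n => (class_size (y n.+1) b)%:R / n.+1%:R * (1 + n%:R^-1) - n%:R^-1 : R)
    @ \oo --> w b.
  have inv0 : (fun n => n%:R^-1 : R) @ \oo --> (0 : R).
    by rewrite -cvg_shiftS; exact: cvg_harmonic.
  rewrite -[w b]subr0 -[w b]mulr1 -[in X in _ * X](addr0 1).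
  apply: cvgB => //; apply: cvgM => //; apply: cvgD => //; exact: cvg_cst.
have H3 : (fun n => (class_size (y n.+1) b)%:R / n.+1%:R * (1 + n%:R^-1) : R)
    @ \oo --> w b.
  have inv0 : (fun n => n%:R^-1 : R) @ \oo --> (0 : R).
    by rewrite -cvg_shiftS; exact: cvg_harmonic.
  rewrite -[w b]mulr1 -[in X in _ * X](addr0 1).
  apply: cvgM => //; apply: cvgD => //; exact: cvg_cst.
apply: squeeze_cvgr H2 H3.
near=> n.
have n0 : 0 < n%:R :> R by rewrite ltr0n; near: n; exact: nbhs_infty_gt.
have -> : (class_size (y n.+1) b)%:R / n.+1%:R * (1 + n%:R^-1) =
    (class_size (y n.+1) b)%:R / n%:R :> R.
  have : n.+1%:R = n%:R + 1 :> R by rewrite -natr1.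
  move=> ->; field; rewrite gt_eqF//= gt_eqF//; lra.
rewrite (class_size_delete_at (y n.+1) (i n) b) natrD.
rewrite -[X in _ - X]mul1r -mulrBl !ler_pM2r ?invr_gt0//.
by case: (_ == b) => /=; apply/andP; split; lra.
Unshelve. all: by end_near. Qed.

End label_asymptotics.

(** * Convergence of the p-value and of the decisions based on it *)

Lemma card_setU3_le (I : finType) (A B C D : {set I}) :
  {subset A <= [predU B & [predU C & D]]} -> (#|A| <= #|B| + (#|C| + #|D|))%N.
Proof.
move=> sub; apply: (@leq_trans #|B :|: (C :|: D)|).
  by apply/subset_leq_card/fintype.subsetP => i /sub; rewrite !inE.
apply: leq_trans (leq_card_setU _ _) _.
by rewrite leq_add2l; exact: leq_card_setU.
Qed.

(** The term [1 / (N + 1)] accounts for the new observation being counted in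
the p-value. *)
Lemma pvalue_count_dist (R : realFieldType) (c c' u N : nat) :
  (c <= c' + u)%N -> (c' <= c + u)%N -> (c <= N)%N -> (0 < N)%N ->
  `|(c + 1)%:R / (N + 1)%:R - c'%:R / N%:R| <= u%:R / N%:R + (N + 1)%:R^-1 :> R.
Proof.
move=> cc' c'c cN N0.
have N0' : 0 < N%:R :> R by rewrite ltr0n.
have N1 : 0 < (N + 1)%:R :> R by rewrite ltr0n addn1.
have -> : (c + 1)%:R / (N + 1)%:R - c'%:R / N%:R =
   (c%:R - c'%:R) / N%:R + (N%:R - c%:R) / N%:R * (N + 1)%:R^-1 :> R.
  rewrite !natrD in N1 *; field; apply/andP; split; apply: lt0r_neq0; lra.
apply: le_trans (ler_normD _ _) _; apply: lerD.
  rewrite normrM [X in _ * X]gtr0_norm ?invr_gt0// ler_pM2r ?invr_gt0//.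
  have h1 : c%:R <= c'%:R + u%:R :> R by rewrite -natrD ler_nat.
  have h2 : c'%:R <= c%:R + u%:R :> R by rewrite -natrD ler_nat.
  by rewrite ler_norml; apply/andP; split; lra.
have H : 0 <= (N%:R - c%:R) / N%:R :> R.
  by rewrite divr_ge0// subr_ge0 ler_nat.
rewrite ger0_norm; last by rewrite mulr_ge0// invr_ge0 ltW.
apply: ler_piMl; first by rewrite invr_ge0 ltW.
by rewrite ler_pdivrMr// mul1r lerBlDr lerDl.
Qed.

Lemma measure4_le (R : realType) (d' : measure_display) (U : measurableType d')
    (m : probability U R) (A A1 A2 A3 A4 : set U) (eta : R) :
  measurable A -> measurable A1 -> measurable A2 -> measurable A3 -> measurable A4 ->
  A `<=` A1 `|` (A2 `|` (A3 `|` A4)) ->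
  (m A1 <= (eta / 4)%:E)%E -> (m A2 <= (eta / 4)%:E)%E ->
  (m A3 <= (eta / 4)%:E)%E -> (m A4 <= (eta / 4)%:E)%E ->
  (m A <= eta%:E)%E.
Proof.
move=> mA mA1 mA2 mA3 mA4 sub h1 h2 h3 h4.
have mA34 := measurableU _ _ mA3 mA4.
have mA24 := measurableU _ _ mA2 mA34.
apply: le_trans (le_measure m _ _ sub) _; rewrite ?inE//.
  exact: measurableU.
have -> : eta = eta / 4 + (eta / 4 + (eta / 4 + eta / 4)) by field.
apply: le_trans (measureU2 _ _ _) _ => //; rewrite EFinD; apply: leeD => //.
apply: le_trans (measureU2 _ _ _) _ => //; rewrite EFinD; apply: leeD => //.
apply: le_trans (measureU2 _ _ _) _ => //; rewrite EFinD; exact: leeD.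
Qed.

Section pvalue_convergence.
Context (R : realType) (L : nat) (d : measure_display) (S : measurableType d).
Context (P : 'I_L -> probability S R).
Context (Q : forall n, n.-tuple 'I_L -> probability (n.-tuple S) R).
Hypothesis Qbox : forall n (y : n.-tuple 'I_L) (A : 'I_n -> set S),
  (forall i, measurable (A i)) -> Q y (box A) = (\prod_i P (tnth y i) (A i))%E.
Context (theta : 'I_L).
Hypothesis P_dom : forall (b : 'I_L) (eta : R), 0 < eta ->
  exists2 K : R, 0 <= K &
    forall A, measurable A -> (P b A <= K%:E * P theta A + eta%:E)%E.
Context (w : 'I_L -> R).
Hypothesis w_gt0 : forall b, 0 < w b.
Context (T : statistic R L S) (mT : measurable_statistic T).
Context (To : S -> R) (mTo : measurable_fun setT To).
Hypothesis To_atomless : forall b t, P b [set x | To x = t] = 0%E.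

Definition joint_law (b : 'I_L) (n : nat) (y : n.-tuple 'I_L) :
  probability (S * n.-tuple S)%type R := (P b \x Q y)%E.

Lemma joint_lawX (b : 'I_L) (n : nat) (y : n.-tuple 'I_L) (A : set S)
    (B : set (n.-tuple S)) :
  measurable A -> measurable B -> joint_law b y (A `*` B) = (P b A * Q y B)%E.
Proof. exact: product_probabilityE. Qed.

Hypothesis T_cvg : forall y : (forall n, n.-tuple 'I_L), asymptotic_labels w y ->
  forall (b : 'I_L) (e eta : R), 0 < e -> 0 < eta -> \forall n \near \oo,
  (joint_law b (y n) [set p | (e < `|T (y n) p.1 p.2 - To p.1|)%R] <= eta%:E)%E.

Definition survival_pvalue (x : S) : R := fine (P theta [set z | To x <= To z]).
Local Notation po := survival_pvalue.

Lemma measurable_survival_pvalue : measurable_fun setT po.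
Proof.
pose G t : R := fine (P theta [set z | (t <= To z)%R]).
apply: (measurableT_comp (f := G)) => //.
have mge t : measurable [set z | t <= To z] by exact: measurable_le_set.
apply: nonincreasing_measurable => // s t st; apply: fine_le; rewrite ?fin_num_measure//.
by apply: le_measure; rewrite ?inE// => z /=; exact: le_trans.
Qed.

Lemma measurable_pvalue (n : nat) (y : n.-tuple 'I_L) :
  measurable_fun setT (fun p : S * n.-tuple S => pvalue T theta y p.1 p.2).
Proof.
rewrite /pvalue; apply: measurable_funM => //.
under eq_fun do rewrite natrD.
apply: measurable_funD => //.
apply: measurable_count => i.
apply: measurable_le_set; first exact: mT.
exact: (measurableT_comp (mT y) (@measurable_swap_at _ S n i)).
Qed.

Lemma survival_pvalue_atomless (b : 'I_L) (alpha : R) :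
  P b [set x | po x = alpha] = 0%E.
Proof.
apply: survival_level_null => // A mA A0.
apply/eqP; rewrite eq_le measure_ge0 andbT; apply/lee_addgt0Pr => eta eta0.
have [K K0 HK] := P_dom b eta0.
by have := HK A mA; rewrite A0 mule0 !add0e.
Qed.

Section pointwise.
Context (n : nat) (y : n.-tuple 'I_L) (e : R).
Local Notation G := (class_indices y theta).

Definition swap_error (i : 'I_n) (p : S * n.-tuple S) : bool :=
  e < `|T y (swap_at i p).1 (swap_at i p).2 - To (swap_at i p).1|.

Definition near_tie (i : 'I_n) (p : S * n.-tuple S) : bool :=
  `|To p.1 - To (tnth p.2 i)| <= e *+ 2.

Definition above (i : 'I_n) (p : S * n.-tuple S) : bool :=
  To p.1 <= To (tnth p.2 i).

(** An index on which the comparisons of [T] and of [To] differ is one where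
[T(X_i, D_i(X))] is not within [e] of [To(X_i)], or one where [To(X_i)] and
[To(X)] are within [2 * e] of each other. *)
Lemma pvalue_approx (p : S * n.-tuple S) :
  (0 < class_size y theta)%N -> `|T y p.1 p.2 - To p.1| <= e ->
  `|pvalue T theta y p.1 p.2 - #|[set i in G | above i p]|%:R / #|G|%:R| <=
  #|[set i in G | swap_error i p]|%:R / #|G|%:R +
  #|[set i in G | near_tie i p]|%:R / #|G|%:R + (#|G| + 1)%:R^-1.
Proof.
move=> N0 Te; rewrite -mulrDl -natrD; apply: pvalue_count_dist => //.
- apply: card_setU3_le => i; rewrite !inE /above /swap_error /near_tie => /andP[-> /=].
  case: (leP (To p.1) _) => //= h1 h2; case: ltP => //= h3.
  move: Te h3 h2 h1; rewrite /swap_at /= !ler_norml mulr2n => /andP[? ?] /andP[? ?] ? ?.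
  by apply/andP; split; lra.
- apply: card_setU3_le => i; rewrite !inE /above /swap_error /near_tie => /andP[-> /=].
  case: (leP (T y p.1 p.2) _) => //= h1 h2; case: ltP => //= h3.
  move: Te h3 h2 h1; rewrite /swap_at /= !ler_norml mulr2n => /andP[? ?] /andP[? ?] ? ?.
  by apply/andP; split; lra.
- by apply/subset_leq_card/fintype.subsetP => i; rewrite inE => /andP[].
Qed.

End pointwise.

(** Outside four events of probability at most [eta / 4], the statistic is close
to [To] at the new observation, and each of the following is at most [e / 4]: the
fraction of exchanged observations where it is not, the fraction of near ties, and
the fluctuation of the empirical survival function of [To].  The term
[1 / (N + 1)] takes the last quarter of [e]. *)
Lemma pvalue_cvg (y : forall n, n.-tuple 'I_L) : asymptotic_labels w y ->
  forall (b : 'I_L) (e eta : R), 0 < e -> 0 < eta -> \forall n \near \oo,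
  (joint_law b (y n) [set p | (e < `|pvalue T theta (y n) p.1 p.2 - po p.1|)%R]
     <= eta%:E)%E.
Proof.
move=> Hy b e eta e0 eta0.
pose a := e / 4; have a0 : 0 < a by rewrite divr_gt0.
pose h := eta / 4; have h0 : 0 < h by rewrite divr_gt0.
have ha0 : 0 < h * a by rewrite mulr_gt0.
have mdiff : measurable_fun setT (fun p : S * S => To p.1 - To p.2).
  by apply: measurable_funB; exact: measurableT_comp.
have tie0 : (P b \x P theta)%E [set p : S * S | To p.1 - To p.2 = 0] = 0%E.
  apply: integral0_eq => x _ /=.
  rewrite -[RHS](To_atomless theta (To x)); congr (P theta _).
  apply/seteqP; split => z; rewrite /xsection /= !inE /=.
    by move/eqP; rewrite subr_eq0 => /eqP.
  by move=> ->; rewrite subrr.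
have [e2 e20 He2] := small_ball_null mdiff tie0 ha0.
pose e1 := e2 / 2; have e10 : 0 < e1 by rewrite divr_gt0.
have ha2 : 0 < h * a / 2 by rewrite divr_gt0.
have [K K0 HK] := P_dom b ha2.
have hK : 0 < h * a / 2 / (K + 1) by rewrite divr_gt0// ltr_wpDl.
near=> n.
(* the class is large enough for 1 / (N + 1) <= a and for the bound of
   [chebyshev_count] at level a to be at most h *)
have HN : Num.max 1 (Num.max (a^-1) (a ^- 2 / h)) <= (class_size (y n) theta)%:R.
  by near: n; exact: (class_size_cvgy (w_gt0 theta) Hy).
move: HN; rewrite !ge_max => /and3P[N1 Na Nh].
have N0 : (0 < class_size (y n) theta)%N by rewrite -(ltr_nat R) (lt_le_trans _ N1).
set G := class_indices (y n) theta.
have mTd : measurable [set p : S * n.-tuple S | e1 < `|T (y n) p.1 p.2 - To p.1|].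
  apply: measurable_gt_set; apply: measurableT_comp => //.
  by apply: measurable_funB; [exact: mT|exact: measurableT_comp].
have yG i : i \in G -> tnth (y n) i = theta by rewrite inE => /eqP.
have mabove i : measurable [set p : S * n.-tuple S | above i p].
  apply: measurable_le_set; first exact: measurableT_comp.
  by apply: (measurableT_comp mTo); exact: measurable_tnth_comp.
have mswap i : measurable [set p : S * n.-tuple S | swap_error (y n) e1 i p].
  exact: (measurable_preim (@measurable_swap_at _ S n i) mTd).
have mtie i : measurable [set p : S * n.-tuple S | near_tie e1 i p].
  apply: measurable_le_set => //; apply: measurableT_comp => //.
  apply: measurable_funB; first exact: measurableT_comp.
  by apply: (measurableT_comp mTo); exact: measurable_tnth_comp.
have mfrac (bb : 'I_n -> S * n.-tuple S -> bool) :
    (forall i, measurable [set p | bb i p]) ->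
    measurable_fun setT (fun p => #|[set i in G | bb i p]|%:R / #|G|%:R : R).
  by move=> mbb; apply: measurable_funM => //; exact: measurable_count.
have mpo : measurable_fun setT (fun p : S * n.-tuple S => po p.1).
  by apply: measurableT_comp => //; exact: measurable_survival_pvalue.
have mA4 : measurable [set p : S * n.-tuple S |
    a < `|#|[set i in G | above i p]|%:R / #|G|%:R - po p.1|].
  apply: measurable_gt_set; apply: measurableT_comp => //.
  by apply: measurable_funB => //; exact: mfrac.
apply: (@measure4_le _ _ _ (joint_law b (y n)) _
  [set p | e1 < `|T (y n) p.1 p.2 - To p.1|]
  [set p | a < #|[set i in G | swap_error (y n) e1 i p]|%:R / #|G|%:R]
  [set p | a < #|[set i in G | near_tie e1 i p]|%:R / #|G|%:R]
  [set p | a < `|#|[set i in G | above i p]|%:R / #|G|%:R - po p.1|]) => //.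
- apply: measurable_gt_set; apply: measurableT_comp => //.
  by apply: measurable_funB => //; exact: measurable_pvalue.
- by apply: measurable_gt_set; exact: mfrac.
- by apply: measurable_gt_set; exact: mfrac.
- move=> p /= ep.
  case: (ltP e1 `|T (y n) p.1 p.2 - To p.1|) => [|h1]; first by left.
  case: (ltP a (#|[set i in G | swap_error (y n) e1 i p]|%:R / #|G|%:R)) => [|h2].
    by right; left.
  case: (ltP a (#|[set i in G | near_tie e1 i p]|%:R / #|G|%:R)) => [|h3].
    by right; right; left.
  right; right; right.
  have := pvalue_approx N0 h1; rewrite -/G => h4.
  have h5 : (#|G| + 1)%:R^-1 <= a.
    rewrite -[a]invrK lef_pV2 ?posrE ?invr_gt0// ?ltr0n ?addn1//.
    by apply: le_trans Na _; rewrite ler_nat.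
  move: ep; rewrite ltNge => /negP ep; rewrite ltNge; apply/negP => h6; apply: ep.
  have -> : pvalue T theta (y n) p.1 p.2 - po p.1 =
    (pvalue T theta (y n) p.1 p.2 - #|[set i in G | above i p]|%:R / #|G|%:R) +
    (#|[set i in G | above i p]|%:R / #|G|%:R - po p.1) by ring.
  apply: le_trans (ler_normD _ _) _.
  have : e = a + a + a + a by rewrite /a; field.
  by lra.
- by near: n; apply: T_cvg.
- have -> : eta / 4 = h * a / a by rewrite mulfK// gt_eqF.
  apply: markov_count => // i iG.
  (* from class b to class theta, where the exchange is possible *)
  apply: le_trans (_ : (K%:E * joint_law theta (y n)
      [set p | swap_error (y n) e1 i p] + (h * a / 2)%:E <= _)%E).
    by apply: product_measure1_le => //; exact: ltW.
  rewrite -(yG _ iG).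
  have -> : joint_law (tnth (y n) i) (y n) [set p | swap_error (y n) e1 i p] =
     joint_law theta (y n) [set p | (e1 < `|T (y n) p.1 p.2 - To p.1|)%R].
    rewrite -[in RHS](yG _ iG); exact: (swap_at_law Qbox (y n) i mTd).
  apply: (@le_trans _ _ (K%:E * (h * a / 2 / (K + 1))%:E + (h * a / 2)%:E)%E).
    rewrite leeD2r// lee_wpmul2l//; near: n; exact: T_cvg.
  rewrite -EFinM -EFinD lee_fin.
  suff : K * (h * a / 2 / (K + 1)) <= h * a / 2 by lra.
  rewrite mulrCA; apply: ler_piMr; first exact: ltW.
  by rewrite ler_pdivrMr ?mul1r ?lerDl ?ler01// ltr_wpDl.
- have -> : eta / 4 = h * a / a by rewrite mulfK// gt_eqF.
  apply: markov_count => // i iG.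
  apply: le_trans He2; rewrite -(yG _ iG).
  have mE2 : measurable [set p : S * S | `|To p.1 - To p.2| <= e2].
    by apply: measurable_le_set => //; exact: measurableT_comp.
  rewrite le_eqVlt; apply/orP; left; apply/eqP.
  apply: etrans (new_coord_law Qbox b (y n) i mE2).
  congr (joint_law b (y n) _).
  have e1E : e1 *+ 2 = e2 by rewrite /e1 mulr2n; field.
  by apply/seteqP; split => p /=; rewrite /near_tie e1E.
- apply: (@le_trans _ _ (\int[P b]_x h%:E)%E); last first.
    by rewrite integral_cst//= probability_setT mule1.
  apply: ge0_le_integral => //.
  - exact: (measurable_fun_xsection (Q (y n)) mA4).
  move=> x _ /=.
  have mtop : measurable [set z | To x <= To z] by exact: measurable_le_set.
  have -> : xsection [set p : S * n.-tuple S |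
      a < `|#|[set i in G | above i p]|%:R / #|G|%:R - po p.1|] x =
      [set xs | a < `|#|[set i in G | To x <= To (tnth xs i)]|%:R / #|G|%:R - po x|].
    by apply/seteqP; split => xs; rewrite /xsection /= inE.
  apply: le_trans (chebyshev_count (p := po x) _ _ _ _ _) _ => //.
  + move=> i; apply: measurable_le_set => //.
    by apply: (measurableT_comp mTo); exact: measurable_tnth.
  + move=> i iG; rewrite (coord_law Qbox (y n) i mtop) (yG _ iG).
    by rewrite fineK// fin_num_measure.
  + move=> i j iG jG ij.
    rewrite (_ : [set xs | _] =
      [set xs | [set z | To x <= To z] (tnth xs i) /\ [set z | To x <= To z] (tnth xs j)]).
      rewrite (coord2_law Qbox)// (yG _ iG) (yG _ jG) expr2 EFinM.
      by rewrite fineK// fin_num_measure.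
    by apply/seteqP; split => xs /= => [/andP[]//|[-> ->]].
  + by rewrite lee_fin ler_pdivrMr ?ltr0n// mulrC -ler_pdivrMr.
Unshelve. all: by end_near. Qed.

Definition disagree (alpha : R) (n : nat) (y : n.-tuple 'I_L) :
    set (S * n.-tuple S) :=
  [set p | (alpha < pvalue T theta y p.1 p.2) != (alpha < po p.1)].

Lemma measurable_disagree (alpha : R) (n : nat) (y : n.-tuple 'I_L) :
  measurable (disagree alpha y).
Proof.
have mpo : measurable_fun setT (fun p : S * n.-tuple S => po p.1).
  by apply: measurableT_comp => //; exact: measurable_survival_pvalue.
have mA := measurable_gt_set alpha (measurable_pvalue y).
have mB := measurable_gt_set alpha mpo.
rewrite (_ : disagree alpha y =
  ([set p | alpha < pvalue T theta y p.1 p.2] `\` [set p | alpha < po p.1]) `|`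
  ([set p | alpha < po p.1] `\` [set p | alpha < pvalue T theta y p.1 p.2])).
  by apply: measurableU; exact: measurableD.
apply/seteqP; split => p; rewrite /disagree /=.
  case: (alpha < pvalue _ _ _ _ _); case: (alpha < po _) => // _; by [left|right].
by case: (alpha < pvalue _ _ _ _ _); case: (alpha < po _) => // -[] [].
Qed.

(** Decisions can differ only if the two p-values are [e] apart or if the oracle
p-value is within [e] of [alpha]. *)
Lemma disagree_cvg (alpha : R) (y : forall n, n.-tuple 'I_L) :
  asymptotic_labels w y ->
  forall (b : 'I_L) (eta : R), 0 < eta -> \forall n \near \oo,
  (joint_law b (y n) (disagree alpha (y n)) <= eta%:E)%E.
Proof.
move=> Hy b eta eta0.
have mpo := measurable_survival_pvalue.
have mg : measurable_fun setT (fun x => po x - alpha) by exact: measurable_funB.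
have g0 : P b [set x | po x - alpha = 0] = 0%E.
  rewrite -[RHS](survival_pvalue_atomless b alpha); congr (P b _).
  by apply/seteqP; split => x /= => [/eqP|->]; rewrite ?subrr// subr_eq0 => /eqP.
have eta2 : 0 < eta / 2 by rewrite divr_gt0.
have [e e0 He] := small_ball_null mg g0 eta2.
have := pvalue_cvg Hy b e0 eta2; apply: filterS => n Hn.
have mpo1 : measurable_fun setT (fun p : S * n.-tuple S => po p.1).
  exact: measurableT_comp.
have mA : measurable [set p : S * n.-tuple S | e < `|pvalue T theta (y n) p.1 p.2 - po p.1|].
  apply: measurable_gt_set; apply: measurableT_comp => //.
  by apply: measurable_funB => //; exact: measurable_pvalue.
have mB : measurable [set x | `|po x - alpha| <= e].
  by apply: measurable_le_set => //; exact: measurableT_comp.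
have mB' : measurable ([set x | `|po x - alpha| <= e] `*` [set: n.-tuple S]).
  exact: measurableX.
apply: (@le_trans _ _ (joint_law b (y n)
  ([set p | e < `|pvalue T theta (y n) p.1 p.2 - po p.1|] `|`
   ([set x | `|po x - alpha| <= e] `*` [set: n.-tuple S])))).
  apply: le_measure; rewrite ?inE; [exact: measurable_disagree|exact: measurableU|].
  move=> p; rewrite /disagree /= => dis.
  case: (ltP e `|pvalue T theta (y n) p.1 p.2 - po p.1|) => [|h]; [by left|right].
  split => //; move: dis h; rewrite !ler_norml => dis /andP[h1 h2].
  by move: dis; case: ltP => h3; case: ltP => h4 // _; apply/andP; split; lra.
apply: le_trans (measureU2 _ mA mB') _.
rewrite [X in (_ <= X%:E)%E](splitr eta) EFinD; apply: leeD => //.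
by rewrite [X in (X <= _)%E]joint_lawX// probability_setT mule1.
Qed.

(** Uniformity in [i] follows by deleting, for each sample size, an index that
violates the bound, if there is one: the shortened label vectors
have the same limiting class frequencies, so [disagree_cvg] applies to them. *)
Lemma leave_one_out_disagree_cvg (alpha : R) (y : forall n, n.-tuple 'I_L) :
  asymptotic_labels w y ->
  forall (b : 'I_L) (eta : R), 0 < eta -> \forall n \near \oo,
  forall i, i \in class_indices (y n) b ->
  (Q (y n) [set xs | disagree alpha (delete_at i (y n)) (extract_at i xs)]
     <= eta%:E)%E.
Proof.
move=> Hy b eta eta0.
pose bad n (i : 'I_n) := (i \in class_indices (y n) b) &&
  ~~ (joint_law b (delete_at i (y n)) (disagree alpha (delete_at i (y n))) <= eta%:E)%E.
pose i0 n : 'I_n.+1 := odflt ord0 [pick i | bad n.+1 i].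
have [N _ HN] := disagree_cvg alpha (asymptotic_delete_at i0 Hy) b eta0.
exists N.+1 => // -[//|n] /= Nn i ib.
have yi : tnth (y n.+1) i = b by move: ib; rewrite inE => /eqP.
have -> : Q (y n.+1) [set xs | disagree alpha (delete_at i (y n.+1)) (extract_at i xs)]
  = joint_law b (delete_at i (y n.+1)) (disagree alpha (delete_at i (y n.+1))).
  rewrite -yi; apply: (extract_at_law Qbox (y n.+1) i); exact: measurable_disagree.
apply/negPn/negP => Hi.
have : bad n.+1 (i0 n).
  rewrite /i0; case: pickP => //= /(_ i) /negP []; exact/andP.
rewrite /bad => /andP[_ /negP]; apply.
exact: (HN n Nn).
Qed.

(** The estimate is compared with the average of the oracle decisions at the
training observations of class [b], which are independent with common mean. *)
Lemma incl_estimate_cvg (alpha : R) (y : forall n, n.-tuple 'I_L) :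
  asymptotic_labels w y ->
  forall (b : 'I_L) (e eta : R), 0 < e -> 0 < eta -> \forall n \near \oo,
  (Q (y n) [set xs | (e < `|incl_estimate T alpha b theta (y n) xs -
      fine (P b [set x | alpha < po x])|)%R] <= eta%:E)%E.
Proof.
move=> Hy b e eta e0 eta0; set pr := fine _.
have mpo := measurable_survival_pvalue.
have e2 : 0 < e / 2 by rewrite divr_gt0.
have eta2 : 0 < eta / 2 by rewrite divr_gt0.
have e2eta2 : 0 < eta / 2 * (e / 2) by rewrite mulr_gt0.
near=> n.
have HN : Num.max 1 ((e / 2) ^- 2 / (eta / 2)) <= (class_size (y n) b)%:R.
  by near: n; exact: (class_size_cvgy (w_gt0 b) Hy).
move: HN; rewrite !ge_max => /andP[N1 Nh].
have N0 : (0 < class_size (y n) b)%N by rewrite -(ltr_nat R) (lt_le_trans _ N1).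
have loo : forall i, i \in class_indices (y n) b ->
    (Q (y n) [set xs | disagree alpha (delete_at i (y n)) (extract_at i xs)]
       <= (eta / 2 * (e / 2))%:E)%E.
  by near: n; exact: leave_one_out_disagree_cvg.
set G := class_indices (y n) b.
have yG i : i \in G -> tnth (y n) i = b by rewrite inE => /eqP.
pose est i (xs : n.-tuple S) :=
  alpha < pvalue T theta (delete_at i (y n)) (tnth xs i) (delete_at i xs).
pose orc i (xs : n.-tuple S) := alpha < po (tnth xs i).
have mest i : measurable [set xs | est i xs].
  apply: (measurable_preim (@measurable_extract_at _ S n i)
    (A := [set p | alpha < pvalue T theta (delete_at i (y n)) p.1 p.2])).
  exact: measurable_gt_set (measurable_pvalue _).
have mtop : measurable [set x | alpha < po x] by exact: measurable_gt_set.
have morc i : measurable [set xs | orc i xs].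
  exact: (measurable_preim (@measurable_tnth _ S n i) mtop).
have mdis i : measurable [set xs : n.-tuple S | est i xs != orc i xs].
  exact: (measurable_preim (@measurable_extract_at _ S n i)
    (measurable_disagree alpha (delete_at i (y n)))).
have mfrac (bb : 'I_n -> n.-tuple S -> bool) :
    (forall i, measurable [set p | bb i p]) ->
    measurable_fun setT (fun p => #|[set i in G | bb i p]|%:R / #|G|%:R : R).
  by move=> mbb; apply: measurable_funM => //; exact: measurable_count.
have mcheb : measurable [set xs | e / 2 < `|#|[set i in G | orc i xs]|%:R / #|G|%:R - pr|].
  apply: measurable_gt_set; apply: measurableT_comp => //.
  by apply: measurable_funB => //; exact: mfrac.
have mmark : measurable [set xs | e / 2 <
    #|[set i in G | est i xs != orc i xs]|%:R / #|G|%:R].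
  by apply: measurable_gt_set; exact: mfrac.
apply: (@le_trans _ _ (Q (y n)
  ([set xs | e / 2 < #|[set i in G | est i xs != orc i xs]|%:R / #|G|%:R] `|`
   [set xs | e / 2 < `|#|[set i in G | orc i xs]|%:R / #|G|%:R - pr|]))).
  apply: le_measure; rewrite ?inE; [|exact: measurableU|].
    apply: measurable_gt_set; apply: measurableT_comp => //.
    by apply: measurable_funB => //; exact: mfrac.
  move=> xs /= exs.
  case: (ltP (e / 2) (#|[set i in G | est i xs != orc i xs]|%:R / #|G|%:R)) => [|h1].
    by left.
  right; rewrite ltNge; apply/negP => h2.
  move: exs; rewrite ltNge => /negP; apply.
  set c1 : R := _ / _ in h1.
  set c2 := #|[set i in G | orc i xs]|%:R / #|G|%:R in h2.
  have -> : incl_estimate T alpha b theta (y n) xs - pr =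
     (#|[set i in G | est i xs]|%:R / #|G|%:R - c2) + (c2 - pr).
    by rewrite addrA subrK.
  apply: le_trans (ler_normD _ _) _; rewrite [leRHS](splitr e); apply: lerD => //.
  apply: le_trans h1; rewrite /c1 /c2 -mulrBl normrM [X in _ * X]ger0_norm ?invr_ge0//.
  rewrite ler_pM2r ?invr_gt0 ?ltr0n//.
  have card2 (A B C : {set 'I_n}) : {subset A <= [predU B & C]} ->
      #|A|%:R <= #|B|%:R + #|C|%:R :> R.
    move=> sub; rewrite -natrD ler_nat; apply: leq_trans (leq_card_setU _ _).
    by apply/subset_leq_card/fintype.subsetP => i /sub; rewrite !inE.
  have h3 : #|[set i in G | est i xs]|%:R <= #|[set i in G | orc i xs]|%:R +
      #|[set i in G | est i xs != orc i xs]|%:R :> R.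
    by apply: card2 => i; rewrite !inE => /andP[-> ->] /=; case: (orc i xs).
  have h4 : #|[set i in G | orc i xs]|%:R <= #|[set i in G | est i xs]|%:R +
      #|[set i in G | est i xs != orc i xs]|%:R :> R.
    by apply: card2 => i; rewrite !inE => /andP[-> ->] /=; case: (est i xs).
  by rewrite ler_norml; apply/andP; split; lra.
apply: le_trans (measureU2 _ mmark mcheb) _.
rewrite [X in (_ <= X%:E)%E](splitr eta) EFinD; apply: leeD.
  rewrite -[X in (_ <= X%:E)%E](mulfK (lt0r_neq0 e2)).
  exact: markov_count.
have prE : P b [set x | alpha < po x] = pr%:E by rewrite fineK// fin_num_measure.
apply: le_trans (chebyshev_count (p := pr) morc _ _ _ _) _ => //.
- by move=> i iG; rewrite -prE -(yG _ iG); exact: (coord_law Qbox (y n) i mtop).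
- move=> i j iG jG ij.
  rewrite (_ : [set xs | _] =
    [set xs | [set x | alpha < po x] (tnth xs i) /\ [set x | alpha < po x] (tnth xs j)]).
    by rewrite (coord2_law Qbox)// (yG _ iG) (yG _ jG) expr2 EFinM prE.
  by apply/seteqP; split => xs /= => [/andP[]//|[h5 h6]]; apply/andP.
- by rewrite lee_fin ler_pdivrMr ?ltr0n// [leRHS]mulrC -ler_pdivrMr.
Unshelve. all: by end_near. Qed.

End pvalue_convergence.

(** * Conditional probabilities and the law of the sample *)

Lemma near_infty_all (I : finType) (Q : I -> nat -> Prop) :
  (forall i, \forall n \near \oo, Q i n) -> \forall n \near \oo, forall i, Q i n.
Proof.
move=> H; have /choice[N HN] : forall i, exists N, forall n, (N <= n)%N -> Q i n.
  by move=> i; have [N _ HN] := H i; exists N.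
exists (\max_i N i)%N => // n /= Nn i; apply: HN.
by apply: leq_trans Nn; exact: leq_bigmax.
Qed.

(** On the event of [G] where [Z > c + e], integrating [Z] gives [q (E `&` A)],
which exceeds [q (Eo `&` A) = c * q A] by at least [e * q A]; the excess is bounded
by the probability that [E] and [Eo] differ.  The event [Z < c - e] is
symmetric. *)
Lemma cond_prob_deviation (R : realType) (d : measure_display)
    (Omega : measurableType d) (q : probability Omega R) (G : set_system Omega)
    (E Eo Dis : set Omega) (Z : Omega -> R) (c e delta : R) :
  is_cond_prob q G E Z -> G `<=` measurable ->
  measurable E -> measurable Eo -> measurable Dis ->
  E `\` Eo `<=` Dis -> Eo `\` E `<=` Dis ->
  (forall A, G A -> q (Eo `&` A) = c%:E * q A)%E ->
  0 < e -> (q Dis <= delta%:E)%E ->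
  (q [set w | (e < `|Z w - c|)%R] <= (delta / e *+ 2)%:E)%E.
Proof.
move=> [ZG Zint Zcond] Gm mE mEo mDis EEo EoE indep e0 Disd.
pose A := Z @^-1` `]c + e, +oo[%classic.
pose B := Z @^-1` `]-oo, c - e[%classic.
have GA : G A by apply: ZG.
have GB : G B by apply: ZG.
have mA := Gm _ GA; have mB := Gm _ GB.
have int_cst r C : measurable C -> q.-integrable C (EFin \o cst r).
  by move=> mC; exact: finite_measure_integrable_cst.
have intZ C : measurable C -> q.-integrable C (EFin \o Z).
  by move=> mC; apply: integrableS Zint.
have cstE r C : measurable C -> (\int[q]_(w in C) (EFin \o cst r) w = r%:E * q C)%E.
  by move=> mC; exact: (integral_cst q mC r%:E).
have qfin C : measurable C -> q C = (fine (q C))%:E.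
  by move=> mC; rewrite fineK// fin_num_measure.
have cover (C F F' : set Omega) : measurable C -> measurable F -> measurable F' ->
    F `\` F' `<=` Dis -> (q (F `&` C) <= q (F' `&` C) + q Dis)%E.
  move=> mC mF mF' FF'.
  apply: le_trans (measureU2 _ _ _) => //; last exact: measurableI.
  apply: le_measure; rewrite ?inE; [exact: measurableI| |].
    by apply: measurableU => //; exact: measurableI.
  move=> w [Fw Cw]; have [F'w|F'w] := pselect (F' w); [by left|right].
  exact: FF'.
have boundA : (q A <= (delta / e)%:E)%E.
  have : ((c + e)%:E * q A <= c%:E * q A + q Dis)%E.
    rewrite -indep// -cstE//; apply: le_trans (cover _ _ _ mA mE mEo EEo).
    rewrite -Zcond//; apply: le_integral; [exact: mA|exact: int_cst|exact: intZ|].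
    by move=> w; rewrite inE /A /= in_itv/= andbT lee_fin => /ltW.
  move: Disd; rewrite (qfin _ mA) (qfin _ mDis) -!EFinM -EFinD !lee_fin => h1 h2.
  by rewrite ler_pdivlMr//; lra.
have boundB : (q B <= (delta / e)%:E)%E.
  have : (c%:E * q B <= (c - e)%:E * q B + q Dis)%E.
    rewrite -indep// -cstE//; apply: le_trans (cover _ _ _ mB mEo mE EoE) _.
    rewrite leeD2r// -Zcond//; apply: le_integral; [exact: mB|exact: intZ|exact: int_cst|].
    by move=> w; rewrite inE /B /= in_itv/= lee_fin => /ltW.
  move: Disd; rewrite (qfin _ mB) (qfin _ mDis) -!EFinM -EFinD !lee_fin => h1 h2.
  by rewrite ler_pdivlMr//; lra.
have -> : [set w | e < `|Z w - c|] = A `|` B.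
  apply/seteqP; split => w; rewrite /A /B /= !in_itv/= andbT ltr_normr.
    by case/orP => h; [left|right]; lra.
  by case=> h; apply/orP; [left|right]; lra.
apply: le_trans (measureU2 _ mA mB) _.
by rewrite mulr2n EFinD; exact: leeD.
Qed.

Section sampling.
Context (R : realType) (L : nat) (d dO : measure_display).
Context (S : measurableType d) (Omega : measurableType dO).
Context (Pr : probability Omega R) (X : {RV Pr >-> S}) (Y : Omega -> 'I_L).
Hypothesis mY : forall b, measurable (Y @^-1` [set b]).
Hypothesis w_gt0 : forall b, 0 < class_weight Pr Y b.
Local Notation w := (class_weight Pr Y).

Lemma given_classE (b : 'I_L) (A : set Omega) :
  given_class Pr mY b A = (Pr (A `&` Y @^-1` [set b]) * ((w b)^-1)%:E)%E.
Proof.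
pose B := Y @^-1` [set b]; pose ev := Pr (setT `&` B).
rewrite -[LHS]/((if (ev == 0%E) || (ev == +oo%E) then fun U => Pr U
  else fun U => Pr (U `&` B) * ((fine ev)^-1)%:E)%E A) /ev setTI.
case: ifPn => [|//]; move=> /orP[/eqP h|/eqP h].
  by have := w_gt0 b; rewrite /class_weight h ltxx.
by have := probability_le1 Pr (mY b); rewrite h leye_eq.
Qed.

Lemma given_class_le (b : 'I_L) (A : set Omega) : measurable A ->
  (given_class Pr mY b A <= ((w b)^-1)%:E * Pr A)%E.
Proof.
move=> mA; rewrite given_classE muleC lee_wpmul2l//.
  by rewrite lee_fin invr_ge0 ltW.
by apply: le_measure; rewrite ?inE//; exact: measurableI.
Qed.

(** Decomposition of [A] along the classes; the weights are at most one. *)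
Lemma prob_le_given_class (A : set Omega) (eta : R) : measurable A ->
  (forall b, given_class Pr mY b A <= (eta / L%:R)%:E)%E -> (Pr A <= eta%:E)%E.
Proof.
move=> mA HA.
have AE : A = \big[setU/set0]_(b < L) (A `&` Y @^-1` [set b]).
  rewrite -bigcup_seq; apply/seteqP; split => [x Ax|x [i _ []//]].
  by exists (Y x) => //=; exact: mem_index_enum.
rewrite {1}AE measure_bigsetU_ord.
- have L0 : 0 < L%:R :> R by rewrite ltr0n (leq_ltn_trans _ (ltn_ord (Y point))).
  apply: (@le_trans _ _ (\sum_(b < L) (eta / L%:R)%:E)%E).
    apply: lee_sum => b _; apply: le_trans (HA b).
    rewrite given_classE lee_pemulr//= lee_fin.
    rewrite invf_ge1// /class_weight -lee_fin fineK ?fin_num_measure//.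
    exact: probability_le1.
  by rewrite sumEFin sumr_const card_ord -[_ *+ L]mulr_natr mulfVK// gt_eqF.
- by move=> b; exact: measurableI.
- by move=> b b' _ _ [x [[_ /= <-] [_ /= <-]]].
Qed.

Section sample_law.
Context (n : nat) (y : n.-tuple 'I_L) (D : {RV Pr >-> n.-tuple S}).
Hypothesis D_indep : independent_sample X Y D.
Hypothesis D_law : forall (i : 'I_n) (A : set S), measurable A ->
  Pr [set x | A (tnth (D x) i)] = class_law X mY (tnth y i) A.

Lemma pair_sample_indep (C : 'I_L -> set S) (B : 'I_n -> set S) :
  (forall b, measurable (C b)) -> (forall i, measurable (B i)) ->
  Pr ([set x | C (Y x) (X x)] `&` D @^-1` box B) =
    (Pr [set x | C (Y x) (X x)] * \prod_i class_law X mY (tnth y i) (B i))%E.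
Proof.
move=> mC mB.
pose A (o : option 'I_n) : set Omega := if o is Some i
  then [set x | B i (tnth (D x) i)] else [set x | C (Y x) (X x)].
have := D_indep (J := [set: option 'I_n]%SET) (A := A).
have AF : forall o, o \in [set: option 'I_n]%SET ->
    (if o is Some i
     then preimage_set_system setT (fun x => tnth (D x) i) measurable
     else sigma_pair X Y) (A o).
  by move=> [i|] _ /=; [exists (B i) => //; rewrite setTI|exists C].
move=> /(_ AF).
have -> : \big[setI/setT]_(o in [set: option 'I_n]%SET) A o =
    [set x | C (Y x) (X x)] `&` D @^-1` box B.
  rewrite -bigcap_seq_cond; apply/seteqP; split => x /=.
    move=> H; split=> [|i].
      by apply: (H None); rewrite /= mem_index_enum finset.in_setT.
    by apply: (H (Some i)); rewrite /= mem_index_enum finset.in_setT.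
  by move=> [HC HB] [i|] _ //=; exact: HB.
move=> ->; rewrite (bigD1 None) ?inE//=; congr (_ * _)%E.
rewrite (reindex_omap Some id) /=; last by case=> [//|]; rewrite eqxx andbF.
apply: eq_big => [i|i _]; first by rewrite inE eqxx.
exact: D_law.
Qed.

Lemma sample_law_box (B : 'I_n -> set S) : (forall i, measurable (B i)) ->
  distribution Pr D (box B) = (\prod_i class_law X mY (tnth y i) (B i))%E.
Proof.
move=> mB; have := pair_sample_indep (C := fun=> setT) (fun=> measurableT) mB.
rewrite (_ : [set x | _] = setT); last by apply/seteqP; split.
by rewrite setTI probability_setT mul1e.
Qed.

(** Stated for any [m] on the sample space because it serves for the unconditional
law and for the conditional laws given a class. *)
Lemma pair_sample_law (m : probability Omega R) (p : probability S R) :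
  (forall (A : set S) (B : 'I_n -> set S), measurable A ->
    (forall i, measurable (B i)) ->
    m (X @^-1` A `&` D @^-1` box B) =
      (p A * \prod_i class_law X mY (tnth y i) (B i))%E) ->
  forall E, measurable E ->
    m [set x | E (X x, D x)] = (p \x distribution Pr D)%E E.
Proof.
move=> mE E measE.
have mXD : measurable_fun setT (fun x => (X x, D x)).
  by apply/measurable_fun_pairP; split.
pose XD : {mfun Omega >-> (S * n.-tuple S)%type} :=
  HB.pack (fun x => (X x, D x)) (isMeasurableFun.Build _ _ _ _ _ mXD).
apply: (pair_measure_unique (m1 := distribution m XD)
  (m2 := (p \x distribution Pr D)%E)) => // A B mA mB.
rewrite -[RHS]/((p \x distribution Pr D)%E _) product_probabilityE//;
  last exact: measurable_box.
apply: etrans (mE _ _ mA mB) _; congr (_ * _)%E; exact/esym/sample_law_box.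
Qed.

Lemma given_class_pair_sample_law (b : 'I_L) (E : set (S * n.-tuple S)) :
  measurable E ->
  given_class Pr mY b [set x | E (X x, D x)] =
    (class_law X mY b \x distribution Pr D)%E E.
Proof.
apply: pair_sample_law => A B mA mB; rewrite given_classE.
pose C (c : 'I_L) := if c == b then A else set0.
have mC c : measurable (C c) by rewrite /C; case: ifP.
have CE : [set x | C (Y x) (X x)] = X @^-1` A `&` Y @^-1` [set b].
  apply/seteqP; split => x /=; rewrite /C; first by case: eqP.
  by move=> [? ->]; rewrite eqxx.
rewrite setIAC -CE pair_sample_indep// CE muleAC; congr (_ * _)%E.
by rewrite /class_law /distribution /pushforward /= given_classE.
Qed.

Lemma prob_pair_sample_law (E : set (S * n.-tuple S)) : measurable E ->
  Pr [set x | E (X x, D x)] = (distribution Pr X \x distribution Pr D)%E E.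
Proof.
apply: pair_sample_law => A B mA mB.
exact: (pair_sample_indep (C := fun=> A)).
Qed.

End sample_law.

End sampling.

(** * Consistency of the p-value, of its risk and of its inclusion probabilities *)

Theorem theorem3p1 (R : realType) (L : nat) (L_ge2 : (2 <= L)%N)
    (d dO : measure_display) (S : measurableType d) (Omega : measurableType dO)
    (Pr : probability Omega R)
    (* the random pair (X, Y) *)
    (X : {RV Pr >-> S}) (Y : Omega -> 'I_L)
    (mY : forall b, measurable (Y @^-1` [set b]))
    (w_gt0 : forall b, 0 < class_weight Pr Y b)
    (* strictly positive densities with respect to M *)
    (M : {measure set S -> \bar R}) (f : 'I_L -> S -> R)
    (mf : forall b, measurable_fun setT (f b))
    (f_gt0 : forall b x, 0 < f b x)
    (f_density : forall b (A : set S), measurable A ->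
       class_law X mY b A = (\int[M]_(x in A) (f b x)%:E)%E)
    (* for each label vector, the feature vectors of the training data *)
    (D : forall n, n.-tuple 'I_L -> {RV Pr >-> n.-tuple S})
    (D_indep : forall n (y : n.-tuple 'I_L), independent_sample X Y (D n y))
    (D_law : forall n (y : n.-tuple 'I_L) (i : 'I_n) (A : set S),
       measurable A ->
       Pr [set w | A (tnth (D n y w) i)] = class_law X mY (tnth y i) A)
    (theta : 'I_L)
    (T : statistic R L S)
    (mT : measurable_statistic T)
    (T_sym : symmetric_in_class T theta)
    (To : S -> R)
    (mTo : measurable_fun setT To)
    (T_cvg : cvg_asymptotic Pr (class_weight Pr Y)
       (fun n y w => T n y (X w) (D n y w)) (fun w => To (X w)))
    (To_continuous : forall t : R, Pr [set w | To (X w) = t] = 0%E) :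
  cvg_asymptotic Pr (class_weight Pr Y)
    (fun n y w => pvalue T theta y (X w) (D n y w))
    (fun w => oracle_pvalue X mY To theta (X w))
  /\
  forall alpha : R, 0 < alpha < 1 ->
    (* the conditional probabilities given D are arbitrary versions Z *)
    (forall Z : (forall n, n.-tuple 'I_L -> Omega -> R),
       (forall n (y : n.-tuple 'I_L),
          is_cond_prob Pr (preimage_set_system setT (D n y) measurable)
            [set w | alpha < pvalue T theta y (X w) (D n y w)] (Z n y)) ->
       cvg_asymptotic Pr (class_weight Pr Y) Z
         (cst (risk X alpha (oracle_pvalue X mY To theta))))
    /\
    forall b : 'I_L,
      (forall Z : (forall n, n.-tuple 'I_L -> Omega -> R),
         (forall n (y : n.-tuple 'I_L),
            is_cond_prob (given_class Pr mY b)
              (preimage_set_system setT (D n y) measurable)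
              [set w | alpha < pvalue T theta y (X w) (D n y w)] (Z n y)) ->
         cvg_asymptotic Pr (class_weight Pr Y) Z
           (cst (fine (given_class Pr mY b
              [set w | alpha < oracle_pvalue X mY To theta (X w)]))))
      /\
      cvg_asymptotic Pr (class_weight Pr Y)
        (fun n y w => incl_estimate T alpha b theta y (D n y w))
        (cst (fine (given_class Pr mY b
           [set w | alpha < oracle_pvalue X mY To theta (X w)]))).
Proof.
pose P := class_law X mY.
pose Q n (y : n.-tuple 'I_L) : probability (n.-tuple S) R := distribution Pr (D n y).
have L0 : 0 < L%:R :> R by rewrite ltr0n (leq_ltn_trans _ L_ge2).
have Qbox n (y : n.-tuple 'I_L) (A : 'I_n -> set S) :
    (forall i, measurable (A i)) -> Q n y (box A) = (\prod_i P (tnth y i) (A i))%E.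
  exact: (sample_law_box (D_indep n y) (D_law n y)).
have given_law b n (y : n.-tuple 'I_L) (E : set (S * n.-tuple S)) : measurable E ->
    given_class Pr mY b [set x | E (X x, D n y x)] = joint_law P Q b y E.
  exact: (given_class_pair_sample_law w_gt0 (D_indep n y) (D_law n y)).
have P_dom b (eta : R) : 0 < eta -> exists2 K : R, 0 <= K &
    forall A, measurable A -> (P b A <= K%:E * P theta A + eta%:E)%E.
  apply: (density_domination (mf b) (mf theta)) => //.
  - by move=> x; exact: ltW.
  - exact: f_density.
  - exact: f_density.
have To_atomless b t : P b [set x | To x = t] = 0%E.
  have mt : measurable [set x | To x = t].
    exact: (measurable_preim mTo (measurable_set1 t)).
  apply/eqP; rewrite eq_le measure_ge0 andbT.
  apply: le_trans (given_class_le mY w_gt0 b (measurable_preim _ mt)) _ => //.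
  by rewrite [X in (_ * X)%E]To_continuous mule0.
have mTd n (y : n.-tuple 'I_L) (e : R) :
    measurable [set p : S * n.-tuple S | e < `|T n y p.1 p.2 - To p.1|].
  apply: measurable_gt_set; apply: measurableT_comp => //.
  by apply: measurable_funB; [exact: mT|exact: measurableT_comp].
have mXD n (y : n.-tuple 'I_L) : measurable_fun setT (fun x => (X x, D n y x)).
  by apply/measurable_fun_pairP; split.
have mev n (y : n.-tuple 'I_L) (E : set (S * n.-tuple S)) : measurable E ->
    measurable [set x | E (X x, D n y x)].
  by move=> mE; exact: (measurable_preim (mXD n y) mE).
have T_joint (y : forall n, n.-tuple 'I_L) : asymptotic_labels (class_weight Pr Y) y ->
    forall b (e eta : R), 0 < e -> 0 < eta -> \forall n \near \oo,
    (joint_law P Q b (y n) [set p | (e < `|T n (y n) p.1 p.2 - To p.1|)%R]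
       <= eta%:E)%E.
  move=> Hy b e eta e0 eta0.
  have /cvge0P H := T_cvg y Hy _ e0.
  have := H (fun n => measure_ge0 _ _) (eta * class_weight Pr Y b) (mulr_gt0 eta0 (w_gt0 b)).
  apply: filterS => n Hn.
  rewrite -given_law//.
  apply: le_trans (given_class_le mY w_gt0 b (mev _ _ _ (mTd _ _ _))) _.
  rewrite lee_pdivrMl//; apply: le_trans Hn _.
  by rewrite mulrC EFinM.
have mpo := measurable_survival_pvalue P theta mTo.
split.
  move=> y Hy e e0; apply/cvge0P => [n|eta eta0]; first exact: measure_ge0.
  have etaL : 0 < eta / L%:R by rewrite divr_gt0.
  have := near_infty_all (fun b => pvalue_cvg Qbox P_dom w_gt0 mT mTo To_atomless
    T_joint Hy b e0 etaL).
  apply: filterS => n Hn.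
  have mE : measurable [set p : S * n.-tuple S |
      e < `|pvalue T theta (y n) p.1 p.2 - survival_pvalue P theta To p.1|].
    apply: measurable_gt_set; apply: measurableT_comp => //.
    apply: measurable_funB; first exact: measurable_pvalue.
    exact: measurableT_comp.
  apply: (prob_le_given_class w_gt0 (mev _ _ _ mE)) => b.
  by rewrite given_law.
move=> alpha /andP[alpha0 alpha1].
pose Eo := [set x | alpha < survival_pvalue P theta To (X x)].
have mtop : measurable [set x | alpha < survival_pvalue P theta To x].
  exact: measurable_gt_set.
have mEo : measurable Eo by exact: (measurable_preim _ mtop).
pose E n (y : n.-tuple 'I_L) := [set x | alpha < pvalue T theta y (X x) (D n y x)].
have mE n (y : n.-tuple 'I_L) : measurable (E n y).
  apply: (mev _ _ [set p | alpha < pvalue T theta y p.1 p.2]).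
  by apply: measurable_gt_set; exact: measurable_pvalue.
pose Dis n (y : n.-tuple 'I_L) :=
  [set x | disagree P theta T To alpha y (X x, D n y x)].
have mdis n (y : n.-tuple 'I_L) : measurable (disagree P theta T To alpha y).
  exact: measurable_disagree.
have mDis n (y : n.-tuple 'I_L) : measurable (Dis n y) by exact: mev.
have EEo n (y : n.-tuple 'I_L) : E n y `\` Eo `<=` Dis n y.
  by move=> x [/= Ex /negP/negbTE Eox]; rewrite /Dis /disagree /= Ex Eox.
have EoE n (y : n.-tuple 'I_L) : Eo `\` E n y `<=` Dis n y.
  by move=> x [/= Eox /negP/negbTE Ex]; rewrite /Dis /disagree /= Ex Eox.
have Dis_cvg (y : forall n, n.-tuple 'I_L) : asymptotic_labels (class_weight Pr Y) y ->
    forall eta : R, 0 < eta -> \forall n \near \oo, forall b,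
    (given_class Pr mY b (Dis n (y n)) <= eta%:E)%E.
  move=> Hy eta eta0.
  have := near_infty_all (fun b => disagree_cvg Qbox P_dom w_gt0 mT mTo To_atomless
    T_joint alpha Hy b eta0).
  by apply: filterS => n Hn b; rewrite given_law.
have Gm n (y : n.-tuple 'I_L) :
    preimage_set_system setT (D n y) measurable `<=` measurable.
  by move=> _ [B mB <-]; apply: measurableI => //; exact: measurable_preim.
split.
  move=> Z HZ y Hy e e0; apply/cvge0P => [n|eta eta0]; first exact: measure_ge0.
  have delta0 : 0 < eta * e / 2 / L%:R by rewrite !divr_gt0// mulr_gt0.
  have := Dis_cvg y Hy _ delta0; apply: filterS => n Hn.
  have HD : (Pr (Dis n (y n)) <= (eta * e / 2)%:E)%E.
    exact: (prob_le_given_class w_gt0 (mDis _ _) Hn).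
  have -> : eta = eta * e / 2 / e *+ 2 by rewrite mulr2n; field; rewrite gt_eqF.
  apply: (cond_prob_deviation (HZ n (y n)) (Gm _ _) (mE _ _) mEo (mDis _ _)
    (EEo _ _) (EoE _ _) _ e0 HD) => _ [B mB <-]; rewrite setTI.
  have := prob_pair_sample_law (D_indep n (y n)) (D_law n (y n))
    (measurableX mtop mB).
  rewrite product_probabilityE// => H; apply: etrans H _.
  by rewrite /risk fineK ?fin_num_measure.
move=> b; split; last first.
  move=> y Hy e e0; apply/cvge0P => [n|eta eta0]; first exact: measure_ge0.
  exact: (incl_estimate_cvg Qbox P_dom w_gt0 mT mTo To_atomless T_joint alpha Hy b
    e0 eta0).
move=> Z HZ y Hy e e0; apply/cvge0P => [n|eta eta0]; first exact: measure_ge0.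
have delta0 : 0 < eta * e / 2 by rewrite !divr_gt0// mulr_gt0.
have := Dis_cvg y Hy _ delta0; apply: filterS => n /(_ b) HD.
have marginal B : measurable B ->
    given_class Pr mY b (D n (y n) @^-1` B) = Pr (D n (y n) @^-1` B).
  move=> mB; have := given_law b n (y n) _ (measurableX measurableT mB).
  rewrite joint_lawX// probability_setT mul1e => H; apply: etrans H.
  by congr (given_class _ _ _ _); apply/seteqP; split => x //= [].
have [ZG _ _] := HZ n (y n).
set c := fine _.
(* the deviation event is determined by the training data, which are
   independent of Y, so it has the same probability given Y = b *)
have [B mB devE] : preimage_set_system setT (D n (y n)) measurable
    [set x | e < `|Z n (y n) x - c|].
  apply: (ZG [set z | e < `|z - c|]); apply: measurable_gt_set.
  by apply: measurableT_comp => //; exact: measurable_funB.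
rewrite -[X in (Pr X <= _)%E]devE setTI -marginal// -[_ @^-1` B]setTI devE.
have -> : eta = eta * e / 2 / e *+ 2 by rewrite mulr2n; field; rewrite gt_eqF.
apply: (cond_prob_deviation (HZ n (y n)) (Gm _ _) (mE _ _) mEo (mDis _ _)
    (EEo _ _) (EoE _ _) _ e0 HD) => _ [B' mB' <-]; rewrite setTI marginal//.
have := given_law b n (y n) _ (measurableX mtop mB').
rewrite joint_lawX// => H; apply: etrans H _.
by rewrite /c fineK ?fin_num_measure.
Qed.
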